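(* Let $A$ be a subset of Schreier's space $S$. The following assertions are equivalent: (a) $A$ is a Banach-Saks set; (b) $A$ is relatively $\mathcal{P}$-compact; (c) $A$ is relatively weakly compact in $S$, and relatively compact as a subset of $\ell_\infty$.
   Context: A finite subset $A=\{n_1<\cdots<n_k\}$ of $\mathbb{N}=\{1,2,\dots\}$ is admissible if $k\le n_1$. Schreier's space $S$ is the completion of the space $c_{00}$ of finitely supported scalar sequences under the norm $\|x\|_S=\sup\{\sum_{j\in A}|x_j| : A\subset\mathbb{N}\text{ admissible}\}$. Elements of $S$ are regarded as scalar sequences, so that $S\subset\ell_\infty$ (continuously) by the natural inclusion. A subset $A$ of a Banach space $E$ is a Banach-Saks set if every sequence in $A$ has a subsequence whose arithmetic means converge in norm. For a Banach space $E$, ${\mathcal P}({}^kE)$ is the space of scalar-valued continuous $k$-homogeneous polynomials on $E$. A sequence $(x_n)\subset E$ is $\mathcal{P}$-convergent to $x\in E$ if $P(x_n)\to P(x)$ for every $k\in\mathbb{N}$ and every $P\in{\mathcal P}({}^kE)$. A set $A\subset E$ is relatively $\mathcal{P}$-compact if every sequence in $A$ has a $\mathcal{P}$-convergent subsequence (with limit in $E$). *)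

(* Defs.v *)
From HB Require Import structures.
From mathcomp Require Import all_boot all_order all_algebra.
From mathcomp Require Import finmap.
From mathcomp Require Import all_classical all_reals all_analysis.
From mathcomp Require Import complex.

Set Implicit Arguments.
Unset Strict Implicit.
Unset Printing Implicit Defensive.

Import Order.TTheory GRing.Theory Num.Theory.
Import numFieldNormedType.Exports.

Local Open Scope classical_set_scope.
Local Open Scope ring_scope.

Section BanachNotions.
Variables (K : numFieldType) (E : completeNormedModType K).

Definition banach_saks_set (A : set E) : Prop :=
  forall u : nat -> E, (forall n, A (u n)) ->
  exists phi : nat -> nat, {homo phi : m n / (m < n)%N} /\
    cvgn (fun n => n.+1%:R^-1 *: \sum_(i < n.+1) u (phi i)).

Definition multilinear_form k (M : ('I_k -> E) -> K) : Prop :=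
  forall (x : 'I_k -> E) (i : 'I_k),
    scalar (fun v : E => M (dfwith x i v)).

Definition continuous_homogeneous_polynomial k (P : E -> K) : Prop :=
  exists M : {ptws 'I_k -> E} -> K,
    [/\ multilinear_form M, continuous M & forall x, P x = M (fun=> x)].

Definition P_converges (u : nat -> E) (l : E) : Prop :=
  forall (k : nat) (P : E -> K), (0 < k)%N ->
    continuous_homogeneous_polynomial k P -> P (u n) @[n --> \oo] --> P l.

Definition relatively_P_compact (A : set E) : Prop :=
  forall u : nat -> E, (forall n, A (u n)) ->
  exists phi : nat -> nat, {homo phi : m n / (m < n)%N} /\
    exists l : E, P_converges (u \o phi) l.

Definition topological_dual : Type :=
  {f : E -> K | scalar f /\ continuous f}.

Definition dual_pairing (x : E) : {ptws topological_dual -> K} :=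
  fun f => sval f x.

(* The initial topology for the functionals of the dual is the weak topology
   sigma(E, E'). *)
Definition relatively_weakly_compact (A : set E) : Prop :=
  precompact (A : set (initial_topology dual_pairing)).

End BanachNotions.

(* The properties of R and C on which the constructions below rely. The order
   of a numFieldType is partial: on C, x <= y means that y - x is a nonnegative
   real, so [supremums] of a set of nonnegative elements are the usual ones. *)
Record scalar_field := ScalarField {
  scalar_sort :> numFieldType;
  scalar_sup : forall A : set scalar_sort,
    A !=set0 -> (forall x, A x -> 0 <= x) -> has_ubound A ->
    supremums A !=set0;
  scalar_complete : forall G : set_system scalar_sort,
    ProperFilter G -> cauchy G -> cvg G }.

Section RealScalars.
Variable R : realType.

Let real_sup (A : set R) : A !=set0 -> (forall x, A x -> 0 <= x) ->
  has_ubound A -> supremums A !=set0.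
Proof.
move=> A0 _ Aub; exists (sup A); split; first exact: sup_upper_bound.
by move=> y Ay; exact: ge_sup.
Qed.

Definition real_scalars : scalar_field :=
  @ScalarField R real_sup (@R_complete R).

End RealScalars.

Section ComplexScalars.
Variable R : realType.
Local Open Scope complex_scope.
Let C : numFieldType := R[i].

Let complex_sup (A : set C) : A !=set0 -> (forall x, A x -> 0 <= x) ->
  has_ubound A -> supremums A !=set0.
Proof.
move=> [a Aa] A0 [M AM].
have ReA x : A x -> x = (complex.Re x)%:C.
  move=> Ax; apply/eqP; rewrite eq_complex /= eqxx /=.
  by apply/eqP; exact/ger0_Im/A0.
pose B := [set complex.Re x | x in A].
have leRe (x y : C) : x <= y -> complex.Re x <= complex.Re y by rewrite lecE => /andP[].
have Bub : has_ubound B by exists (complex.Re M) => _ [x Ax <-]; exact/leRe/AM.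
exists ((sup B)%:C); split => [x Ax|y Ay].
  by rewrite (ReA _ Ax) lecR; apply: ub_le_sup => //; exists x.
have Imy : complex.Im y = 0.
  by apply: ger0_Im; exact: le_trans (A0 _ Aa) (Ay _ Aa).
rewrite lecE /= Imy eqxx /=; apply: ge_sup; first by exists (complex.Re a), a.
by move=> _ [x Ax <-]; exact/leRe/Ay.
Qed.

Let normc_le (z : C) : `|z| <= `|complex.Re z|%:C + `|complex.Im z|%:C.
Proof.
rewrite [in leLHS](complexE z); apply: (le_trans (ler_normD _ _)).
rewrite normrM; set i := 'i.
have -> : `|i| = 1 :> C by rewrite normc_def /= expr0n /= add0r expr1n sqrtr1.
rewrite mul1r.
have nR (x : R) : `|x%:C| = `|x|%:C :> C.
  by rewrite normc_def /= expr0n /= addr0 sqrtr_sqr.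
by rewrite !nR.
Qed.

Let normc_ge_Im (z : C) : `|complex.Im z|%:C <= `|z|.
Proof.
have := normc_ge_Re (z * 'i); rewrite ReiNIm normrN => /le_trans; apply.
rewrite normrM normc_def /= [X in _ * X]normc_def /= expr0n /= add0r expr1n.
by rewrite sqrtr1 mulr1.
Qed.

Let part_cvg (p : C -> R) (G : set_system C) :
  (forall z w, p (z - w) = p z - p w) -> (forall z, `|p z|%:C <= `|z|) ->
  ProperFilter G -> cauchy G -> cvg (p @ G).
Proof.
move=> pB pn FG /cauchy_ballP Gc; apply: R_complete.
apply/cauchy_ballP => e e0.
have eC : 0 < e%:C :> C by rewrite ltcR.
have := Gc _ eC; rewrite !near_simpl => -[[U V] [/= GU GV] UV].
exists ([set p z | z in U], [set p z | z in V]) => /=.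
  split; rewrite /nbhs /= /fmap /=.
    by apply: filterS GU => z Uz; exists z.
  by apply: filterS GV => z Vz; exists z.
move=> [_ _] [/= [z Uz <-] [w Vw <-]].
have := UV (z, w) (conj Uz Vw); rewrite /= -!ball_normE /= => zw.
by rewrite -pB -ltcR; exact: le_lt_trans (pn _) zw.
Qed.

Let complex_complete (G : set_system C) : ProperFilter G -> cauchy G -> cvg G.
Proof.
move=> FG Gc.
have ReB (z w : C) : complex.Re (z - w) = complex.Re z - complex.Re w by case: z w => [? ?] [].
have ImB (z w : C) : complex.Im (z - w) = complex.Im z - complex.Im w by case: z w => [? ?] [].
have /cvg_ex [/= a Ga] := part_cvg ReB (fun z => normc_ge_Re z) FG Gc.
have /cvg_ex [/= b Gb] := part_cvg ImB normc_ge_Im FG Gc.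
pose l : C := a +i* b.
suff Gl : (id @ G) --> l by apply: (cvgP l); exact: Gl.
apply/cvgrPdist_lt => e e0.
have eE : e = (complex.Re e)%:C.
  by apply/eqP; rewrite eq_complex /= eqxx /=; apply/eqP/ger0_Im/ltW.
have e2 : 0 < complex.Re e / 2.
  by rewrite divr_gt0 //; move: e0; rewrite [e]eE ltcR.
move/cvgrPdist_lt: Ga => /(_ _ e2) Ga; move/cvgrPdist_lt: Gb => /(_ _ e2) Gb.
near=> z; apply: le_lt_trans (normc_le _) _; rewrite eE [complex.Re e]splitr.
rewrite ReB ImB -rmorphD ltcR /=; apply: ltrD; near: z.
  exact: Ga.
exact: Gb.
Unshelve. all: by end_near. Qed.

Definition complex_scalars : scalar_field :=
  @ScalarField C complex_sup complex_complete.

End ComplexScalars.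


Section NonnegativeSup.
Variables (F : scalar_field) (B : set F).
Hypothesis B_ge0 : forall b, B b -> 0 <= b.

Lemma supremum_ub b : has_ubound B -> B b -> b <= supremum 0 B.
Proof.
move=> Bub Bb; rewrite /supremum; case: ifPn => [/eqP B0|_].
  by move: Bb; rewrite B0.
have B0 : B !=set0 by exists b.
case: xgetP => [x _ [xub _]|]; first exact: xub.
by have [y By] := scalar_sup B0 B_ge0 Bub => /(_ y).
Qed.

Lemma supremum_le M : B !=set0 -> ubound B M -> supremum 0 B <= M.
Proof.
move=> B0 BM; have Bub : has_ubound B by exists M.
rewrite /supremum; case: ifPn => [/eqP B00|_].
  by have [b] := B0; rewrite B00.
case: xgetP => [x _ [_ xlb]|]; first exact: xlb.
by have [y By] := scalar_sup B0 B_ge0 Bub => /(_ y).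
Qed.

End NonnegativeSup.

Section LInfinity.
Variable F : scalar_field.

Definition bounded_seq : {pred nat -> F} :=
  fun x => `[< exists M, forall n, `|x n| <= M >].

Lemma bounded_seq_submod_closed : submod_closed bounded_seq.
Proof.
split=> [|a x y /asboolP[M xM] /asboolP[N yN]]; apply/asboolP.
  by exists 0 => n; rewrite normr0.
exists (`|a| * M + N) => n; rewrite (le_trans (ler_normD _ _)) ?lerD ?yN//.
by rewrite normrZ ler_wpM2l.
Qed.

HB.instance Definition _ :=
  GRing.isSubmodClosed.Build F (nat -> F) bounded_seq bounded_seq_submod_closed.

Record linf := Linf { linf_val : nat -> F; _ : linf_val \in bounded_seq }.

HB.instance Definition _ := [isSub for linf_val].
HB.instance Definition _ := [Choice of linf by <:].
HB.instance Definition _ := [SubChoice_isSubLmodule of linf by <:].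

Definition linf_norm (x : linf) : F :=
  supremum 0 [set `|linf_val x n| | n in [set: nat]].

Let linf_set_ge0 (x : linf) b : [set `|linf_val x n| | n in [set: nat]] b -> 0 <= b.
Proof. by move=> [n _ <-]. Qed.

Lemma linf_norm_ge (x : linf) n : `|linf_val x n| <= linf_norm x.
Proof.
apply: supremum_ub; [exact: linf_set_ge0| |by exists n].
have /asboolP[M xM] := valP x; exists M => _ [m _ <-]; exact: xM.
Qed.

Lemma linf_norm_le (x : linf) M :
  (forall n, `|linf_val x n| <= M) -> linf_norm x <= M.
Proof.
move=> xM; apply: supremum_le; first exact: linf_set_ge0.
  by exists `|linf_val x 0|, 0%N.
by move=> _ [n _ <-].
Qed.

Let linf_normD x y : linf_norm (x + y) <= linf_norm x + linf_norm y.
Proof.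
apply: linf_norm_le => n; apply: (le_trans (ler_normD _ _)).
by rewrite lerD ?linf_norm_ge.
Qed.

Let linf_normZ a x : linf_norm (a *: x) = `|a| * linf_norm x.
Proof.
have le b y : linf_norm (b *: y) <= `|b| * linf_norm y.
  apply: linf_norm_le => n; rewrite [linf_val _ _]/(b * linf_val y n) normrM.
  by rewrite ler_wpM2l ?linf_norm_ge.
apply/le_anti; rewrite le /=; have [->|a0] := eqVneq a 0.
  by rewrite normr0 mul0r; apply: le_trans (linf_norm_ge _ 0%N).
have := le a^-1 (a *: x); rewrite scalerA mulVf // scale1r normfV.
by rewrite ler_pdivlMl ?normr_gt0.
Qed.

Let linf_norm_eq0 x : linf_norm x = 0 -> x = 0.
Proof.
move=> x0; apply/val_inj/funext => n /=; apply/eqP.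
by rewrite -normr_le0 -x0 linf_norm_ge.
Qed.

HB.instance Definition _ :=
  Lmodule_isNormed.Build F linf linf_normD linf_normZ linf_norm_eq0.

End LInfinity.

Section Schreier.
Variable F : scalar_field.

(* Sequences are indexed from 0: index j stands for the positive integer j + 1.
   The bound at every n in A amounts to the bound at min A. *)
Definition admissible : set {fset nat} :=
  [set A : {fset nat} | forall n, n \in A -> (#|` A| <= n.+1)%N].

Definition admissible_sum (x : nat -> F) (A : {fset nat}) : F :=
  \sum_(j <- A) `|x j|.

Definition c00 : set (nat -> F) := [set x | finite_set [set n | x n != 0]].

(* The sequences in the closure of c00 for the Schreier norm; they realize the
   completion, by [schreier_normE], [c00_dense] and the instance of [Complete]
   below. *)
Definition schreier_seq : {pred nat -> F} := fun x =>
  `[< forall e : F, 0 < e -> exists2 y, c00 y &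
        forall A, admissible A -> admissible_sum (x - y) A <= e >].

Lemma admissible_sum_ge0 x A : 0 <= admissible_sum x A.
Proof. by apply: sumr_ge0. Qed.

Lemma admissible_sumD x y A :
  admissible_sum (x + y) A <= admissible_sum x A + admissible_sum y A.
Proof. by rewrite -big_split /=; apply: ler_sum => j _; exact: ler_normD. Qed.

Lemma admissible_sumZ (a : F) x A :
  admissible_sum (a *: x) A = `|a| * admissible_sum x A.
Proof. by rewrite mulr_sumr; apply: eq_bigr => j _; exact: normrM. Qed.

Lemma admissible1 n : admissible [fset n]%fset.
Proof. by move=> m; rewrite cardfs1. Qed.

Lemma admissible_sum1 x n : admissible_sum x [fset n]%fset = `|x n|.
Proof. by rewrite /admissible_sum big_seq_fset1. Qed.

Lemma c00_sum_bounded x : c00 x ->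
  exists M, forall A, admissible_sum x A <= M.
Proof.
move=> /finite_fsetP [X Xx]; exists (\sum_(j <- X) `|x j|) => A.
rewrite /admissible_sum (big_fsetID _ (fun j => j \in X)) /=.
rewrite [X in _ + X]big1_fset ?addr0; last first.
  move=> j; rewrite !inE => /andP[_ jX] _; apply/normr0P/eqP/eqP.
  apply: contraNT jX => xj; have : [set n | x n != 0] j by [].
  by rewrite Xx.
rewrite [leRHS](big_fsetID _ (fun j => j \in A)) /=.
rewrite [X in X <= _](_ : _ = \sum_(j <- [fset j in X | j \in A]%fset) `|x j|).
  by rewrite lerDl sumr_ge0.
by congr (\sum_(j <- _) _); congr (enum_fset _); apply/fsetP => j; rewrite !inE andbC.
Qed.

Lemma c00_lincomb (a : F) x y :
  c00 x -> c00 y -> c00 (fun n => a * x n + y n).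
Proof.
move=> x0 y0; apply: (@sub_finite_set _ _
  ([set n | x n != 0] `|` [set n | y n != 0])); last by rewrite finite_setU.
move=> n /= nz; have [xn|] := eqVneq (x n) 0; last by left.
by right; rewrite xn mulr0 add0r in nz.
Qed.

Lemma schreier_seq_submod_closed : submod_closed schreier_seq.
Proof.
split=> [|a x y /asboolP xS /asboolP yS]; apply/asboolP => e e0.
  exists 0 => [|A _].
    rewrite /c00 /= (_ : [set _ | _] = set0) //.
    by rewrite -subset0 => n /=; rewrite eqxx.
  by rewrite subr0 /admissible_sum big1 ?ltW // => j _; rewrite normr0.
have d0 : 0 < e / 2 / (`|a| + 1) by rewrite !divr_gt0 // ltr_wpDl.
have [x' x'0 xx'] := xS _ d0.
have [y' y'0 yy'] := yS (e / 2) (divr_gt0 e0 (ltr0Sn F 1)).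
exists (a *: x' + y') => [|A aA].
  exact: c00_lincomb.
rewrite opprD addrACA -scalerBr; apply: (le_trans (admissible_sumD _ _ _)).
rewrite [leRHS]splitr lerD ?yy' // admissible_sumZ.
apply: (@le_trans _ _ ((`|a| + 1) * (e / 2 / (`|a| + 1)))).
  by rewrite ler_pM ?admissible_sum_ge0 ?xx' ?lerDl.
by rewrite mulrC divfK // gt_eqF // ltr_wpDl.
Qed.

HB.instance Definition _ :=
  GRing.isSubmodClosed.Build F (nat -> F) schreier_seq
    schreier_seq_submod_closed.

Record schreier :=
  Schreier { schreier_val : nat -> F; _ : schreier_val \in schreier_seq }.

HB.instance Definition _ := [isSub for schreier_val].
HB.instance Definition _ := [Choice of schreier by <:].
HB.instance Definition _ := [SubChoice_isSubLmodule of schreier by <:].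

Definition schreier_norm (x : schreier) : F :=
  supremum 0 [set admissible_sum (schreier_val x) A | A in admissible].

Let schreier_set_ge0 (x : schreier) b :
  [set admissible_sum (schreier_val x) A | A in admissible] b -> 0 <= b.
Proof. by move=> [A _ <-]; exact: admissible_sum_ge0. Qed.

Lemma schreier_norm_ge (x : schreier) A : admissible A ->
  admissible_sum (schreier_val x) A <= schreier_norm x.
Proof.
move=> aA; apply: supremum_ub; [exact: schreier_set_ge0| |by exists A].
have /asboolP /(_ 1 ltr01) [y /c00_sum_bounded[M yM] xy] := valP x.
exists (1 + M) => _ [B aB <-].
rewrite -(subrK y (schreier_val x)); apply: (le_trans (admissible_sumD _ _ _)).
by rewrite lerD ?xy.
Qed.

Lemma schreier_norm_le (x : schreier) M :
  (forall A, admissible A -> admissible_sum (schreier_val x) A <= M) ->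
  schreier_norm x <= M.
Proof.
move=> xM; apply: supremum_le; first exact: schreier_set_ge0.
  by exists (admissible_sum (schreier_val x) [fset 0%N]%fset), [fset 0%N]%fset => //;
    exact: admissible1.
by move=> _ [A aA <-]; exact: xM.
Qed.

Let schreier_normD x y :
  schreier_norm (x + y) <= schreier_norm x + schreier_norm y.
Proof.
apply: schreier_norm_le => A aA; apply: (le_trans (admissible_sumD _ _ _)).
by rewrite lerD ?schreier_norm_ge.
Qed.

Let schreier_normZ a x : schreier_norm (a *: x) = `|a| * schreier_norm x.
Proof.
have le b y : schreier_norm (b *: y) <= `|b| * schreier_norm y.
  apply: schreier_norm_le => A aA; rewrite admissible_sumZ.
  by rewrite ler_wpM2l ?schreier_norm_ge.
apply/le_anti; rewrite le /=; have [->|a0] := eqVneq a 0.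
  rewrite normr0 mul0r; apply: le_trans (schreier_norm_ge _ (@admissible1 0)).
  exact: admissible_sum_ge0.
have := le a^-1 (a *: x); rewrite scalerA mulVf // scale1r normfV.
by rewrite ler_pdivlMl ?normr_gt0.
Qed.

Lemma schreier_coord_le (x : schreier) n : `|schreier_val x n| <= schreier_norm x.
Proof. by rewrite -admissible_sum1 schreier_norm_ge //; exact: admissible1. Qed.

Let schreier_norm_eq0 x : schreier_norm x = 0 -> x = 0.
Proof.
move=> x0; apply/val_inj/funext => n /=; apply/eqP.
by rewrite -normr_le0 -x0 schreier_coord_le.
Qed.

HB.instance Definition _ :=
  Lmodule_isNormed.Build F schreier schreier_normD schreier_normZ
    schreier_norm_eq0.

Lemma schreier_normE (x : schreier) :
  `|x| = supremum 0 [set \sum_(j <- A) `|schreier_val x j| | A in admissible].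
Proof. by []. Qed.

Lemma c00_schreier (y : nat -> F) : c00 y -> y \in schreier_seq.
Proof.
move=> y0; apply/asboolP => e e0; exists y => // A _.
by rewrite subrr /admissible_sum big1 ?ltW // => j _; rewrite normr0.
Qed.

Lemma c00_dense : closure [set x : schreier | c00 (schreier_val x)] = setT.
Proof.
apply/seteqP; split => // x _ U /nbhs_ballP [e /= e0 eU].
have /asboolP /(_ _ (divr_gt0 e0 (ltr0Sn F 1))) [y y0 xy] := valP x.
exists (Schreier (c00_schreier y0)); split => //; apply: eU.
rewrite -ball_normE /=; apply: (@le_lt_trans _ _ (e / 2)).
  exact: schreier_norm_le.
by rewrite ltr_pdivrMr // ltr_pMr // ltr1n.
Qed.

Lemma schreier_seq_bounded : {subset schreier_seq <= @bounded_seq F}.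
Proof.
move=> x xS; apply/asboolP; exists `|Schreier xS| => n.
exact: (schreier_coord_le (Schreier xS)).
Qed.

Definition schreier_linf (x : schreier) : linf F :=
  Linf (schreier_seq_bounded (valP x)).

Lemma schreier_complete (G : set_system schreier) :
  ProperFilter G -> cauchy G -> cvg G.
Proof.
move=> FG /cauchy_ballP Gc.
have /choice [x Gx] n : exists l : F, schreier_val z n @[z --> G] --> l.
  suff /cvg_ex : cvg (schreier_val z n @[z --> G]) by [].
  apply: scalar_complete; apply/cauchy_ballP => e e0.
  have := Gc _ e0; rewrite !near_simpl => -[[U V] [/= GU GV] UV].
  exists ([set schreier_val z n | z in U], [set schreier_val z n | z in V]) => /=.
    split; rewrite /nbhs /= /fmap /=.
      by apply: filterS GU => z Uz; exists z.
    by apply: filterS GV => z Vz; exists z.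
  move=> [_ _] [/= [z Uz <-] [w Vw <-]].
  have := UV (z, w) (conj Uz Vw); rewrite /= -!ball_normE /=.
  by apply: le_lt_trans; exact: (schreier_coord_le (z - w)).
have near_sum (s : seq nat) (d : F) : 0 < d ->
    \forall w \near G, \sum_(j <- s) `|x j - schreier_val w j| <= d.
  elim: s d => [d d0|n s IH d d0].
    by near=> w; rewrite big_nil ltW.
  have d2 : 0 < d / 2 := divr_gt0 d0 (ltr0Sn F 1).
  have Gn := (@cvgrPdist_le F F _ G _ _ _).1 (Gx n) _ d2.
  have Gs := IH _ d2.
  near=> w; rewrite big_cons [leRHS]splitr lerD //; near: w.
    exact: Gn.
  exact: Gs.
have Gnear (e : F) : 0 < e -> exists2 U, G U & forall z A, U z -> admissible A ->
    admissible_sum (x - schreier_val z) A <= e.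
  move=> e0; have := Gc _ e0.
  rewrite !near_simpl => -[[U V] [/= GU GV] UV].
  exists V => // z A Vz aA; apply/ler_addgt0Pr => d d0.
  have [w [Uw xw]] := filter_ex (filterI GU (near_sum A d d0)).
  rewrite -[x](subrK (schreier_val w)) -addrA.
  apply: le_trans (admissible_sumD _ _ _) _; rewrite [leRHS]addrC lerD //.
  apply: (@le_trans _ _ `|w - z|); first exact: (schreier_norm_ge (w - z)).
  by have := UV (w, z) (conj Uw Vz); rewrite /= -ball_normE /= => /ltW.
have xS : x \in schreier_seq.
  apply/asboolP => e e0; have e2 : 0 < e / 2 := divr_gt0 e0 (ltr0Sn F 1).
  have [U /filter_ex [z Uz] xz] := Gnear _ e2.
  have /asboolP /(_ _ e2) [y y0 zy] := valP z; exists y => // A aA.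
  rewrite -[x](subrK (schreier_val z)) -addrA.
  apply: le_trans (admissible_sumD _ _ _) _.
  by rewrite [leRHS]splitr lerD ?xz ?zy.
suff Gl : (id @ G) --> (Schreier xS) by apply: (cvgP (Schreier xS)); exact: Gl.
apply/cvgrPdist_le => e e0; have [U GU xU] := Gnear _ e0.
near=> z; apply: schreier_norm_le => A aA.
by apply: xU => //; near: z.
Unshelve. all: by end_near. Qed.

HB.instance Definition _ :=
  Uniform_isComplete.Build schreier schreier_complete.

End Schreier.

(* Main.v *)
From HB Require Import structures.
Require Import Defs.
From mathcomp Require Import all_boot all_order all_algebra.
From mathcomp Require Import finmap.
From mathcomp Require Import all_classical all_reals all_analysis.
From mathcomp Require Import complex ring zify.

(* All three assertions are equivalent to: A is norm bounded and every sequence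
   in A has a subsequence converging in the sup norm to an element of S. The
   engine is that a bounded sequence of S tending to 0 in the sup norm has a
   subsequence dominated by the unit vector basis of c0: its averages tend to 0,
   and random signs show that it is null for every multilinear form. If on the
   other hand a coordinatewise null sequence does not tend to 0 in the sup norm,
   it has a subsequence w_i with almost disjoint humps at coordinates j_i. Schreier
   sets {j_N, ..., j_(2N-1)} then keep the averages away from 0, and so does the
   polynomial x |-> sum_i t_i x(j_i)^2, which is continuous since S embeds
   in l2. Finally S has a shrinking basis, so that the weak topology is coarser
   than the sup norm topology on bounded sets. *)

Set Implicit Arguments.
Unset Strict Implicit.
Unset Printing Implicit Defensive.

Import Order.TTheory GRing.Theory Num.Theory.
Import numFieldNormedType.Exports.

Local Open Scope classical_set_scope.
Local Open Scope ring_scope.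

(** * Extraction of sequences and subsequences *)

(** Degree 1 polynomials cannot detect the sup norm, since a bounded coordinatewise null sequence is
    already weakly null. Degree 2 can: the decreasing rearrangement of x decays like |x| / n, so its
    squares are summable. Norm boundedness is a separate task. For (a) it is read off from
    consecutive means; for (b) and (c) it comes from uniform boundedness. The limit of a subsequence
    must lie in S and not only in l_infty: it is a limit of means under (a), the P-limit under (b),
    and a weak cluster point under (c). Weak compactness is not sequential by definition. It is
    obtained by enclosing A in a weakly continuous image of a sup-norm compact set; conversely, a
    weak cluster point is only asked to meet countably many neighbourhood conditions. Real and
    complex scalars share one interface whose order is partial, so strict comparisons go through
    realness of norms, and an average over signs becomes the choice of the better of two signs. *)

Lemma ex_dependent_seq (X : Type) (G : seq X -> X -> Prop) :
  (forall s, exists x, G s x) ->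
  exists f : nat -> X, forall n, G (mkseq f n) (f n).
Proof.
move=> /choice[next nextP].
pose hist := fix h n := if n is m.+1 then rcons (h m) (next (h m)) else [::].
exists (next \o hist) => n; suff -> : mkseq (next \o hist) n = hist n.
  exact: nextP.
by elim: n => // n IH; rewrite -addn1 /mkseq iotaD map_cat -/(mkseq _ _) IH
  cats1 addn1.
Qed.

(** The extension hypothesis ranges over arbitrary [f], so no invariant on earlier terms has to be
    carried. [Q] takes the position of the new term in order to express thresholds such as 2^-n.
    [x0] only pads the list. *)
Lemma ex_seq_pairwise (X : Type) (x0 : X) (R : nat -> X -> Prop)
    (Q : nat -> X -> X -> Prop) :
  (forall n (f : nat -> X), exists x, R n x /\
    forall i, (i < n)%N -> Q n (f i) x) ->
  exists f : nat -> X, forall n, R n (f n) /\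
    forall i, (i < n)%N -> Q n (f i) (f n).
Proof.
move=> RQ; pose G s x := R (size s) x /\
  forall i, (i < size s)%N -> Q (size s) (nth x0 s i) x.
have [|f fG] := @ex_dependent_seq X G.
  by move=> s; apply: RQ.
exists f => n; have := fG n; rewrite /G size_mkseq => -[Rn Qn];
  split=> // i ltin.
by have := Qn i ltin; rewrite nth_mkseq.
Qed.

Lemma near_all_lt (T : Type) (G : set_system T) {FG : Filter G} n
    (P : nat -> T -> Prop) :
  (forall i, (i < n)%N -> \forall x \near G, P i x) ->
  \forall x \near G, forall i, (i < n)%N -> P i x.
Proof.
elim: n => [|n IH] Pn; first by near=> x.
have Gn := Pn n (ltnSn n).
have GI := IH (fun i lt => Pn i (ltnW lt)).
near=> x => i; rewrite ltnS leq_eqVlt => /predU1P[->|]; first by near: x.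
by move: i; near: x.
Unshelve. all: by end_near. Qed.

Lemma near_infty_gt n : \forall m \near \oo, (n < m)%N.
Proof. by exists n.+1. Qed.

Lemma homo_nat_lt (phi : nat -> nat) :
  (forall n i, (i < n)%N -> (phi i < phi n)%N) ->
  {homo phi : m n / (m < n)%N}.
Proof. by move=> H m n; exact: H. Qed.

Lemma homo_lt_ge (phi : nat -> nat) n :
  {homo phi : m n / (m < n)%N} -> (n <= phi n)%N.
Proof.
by move=> H; elim: n => // n IH; apply: leq_ltn_trans IH (H _ _ (ltnSn n)).
Qed.

Lemma homo_lt_cvg (phi : nat -> nat) :
  {homo phi : m n / (m < n)%N} -> phi @ \oo --> \oo.
Proof.
move=> H A [N _ NA]; exists N => // n /= Nn; apply: NA => /=.
exact: leq_trans Nn (homo_lt_ge _ H).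
Qed.

Lemma not_near_subsequence (P : nat -> Prop) : ~ (\forall n \near \oo, P n) ->
  exists phi : nat -> nat, {homo phi : m n / (m < n)%N} /\
    forall n, ~ P (phi n).
Proof.
move=> nP.
have [|phi phiP] := @ex_seq_pairwise nat 0%N (fun _ n => ~ P n) (fun _ m n =>
  (m < n)%N).
  move=> k f; apply: contrapT => nk; apply: nP.
  apply: filterS (near_all_lt (fun i (_ : (i < k)%N) => near_infty_gt (f i))).
  by move=> n fn; apply: contrapT => Pn; apply: nk; exists n.
exists phi; split=> [|n]; last by have [] := phiP n.
by apply: homo_nat_lt => n i ltin; have [_] := phiP n; exact.
Qed.

(** The space need not be first countable: the subsequence meets countably many neighbourhood
    conditions but need not converge to [y]. This is what makes it usable in the weak topology. *)
Lemma cluster_subsequence (T : topologicalType) (u : nat -> T) (y : T)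
    (P : nat -> T -> Prop) :
  cluster (u @ \oo) y -> (forall n, \forall z \near y, P n z) ->
  exists phi : nat -> nat, {homo phi : m n / (m < n)%N} /\
    forall n, P n (u (phi n)).
Proof.
move=> uy yP.
have [n f|phi phiP] := @ex_seq_pairwise nat 0%N (fun n m => P n (u m))
    (fun _ m n => (m < n)%N).
  have uG : (u @ \oo) [set u m | m in [set m | forall i, (i < n)%N -> (f i <
    m)%N]].
    apply: filterS (near_all_lt (fun i (_ : (i < n)%N) => near_infty_gt (f i))).
    by move=> m fm; exists m.
  by have [_ [[m fm <-] Pm]] := uy _ _ uG (yP n); exists m.
exists phi; split=> [|n]; last by have [] := phiP n.
by apply: homo_nat_lt => n i ltin; have [_] := phiP n; exact.
Qed.

Lemma near_dist_le (K : numFieldType) (V : normedModType K) (x : V) (d : K) :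
  0 < d -> \forall y \near x, `|x - y| <= d.
Proof. by move=> d0; apply/nbhs_normP; exists d => //= y /ltW. Qed.

Lemma ptws_cvg (I : Type) (V : topologicalType) (G : set_system {ptws I -> V})
    (FG : Filter G) (f : {ptws I -> V}) :
  (forall i, g i @[g --> G] --> f i) -> G --> f.
Proof.
move=> Gf; apply/cvg_sup => i U [D [[W oW <-] Wf DU]].
apply: (filterS DU); apply: Gf; exact: open_nbhs_nbhs.
Qed.

Lemma initial_cvg (X : choiceType) (T : topologicalType) (h : X -> T)
    (G : set_system X) (FG : Filter G) (x : X) :
  h @ G --> h x -> G --> (x : initial_topology h).
Proof.
move=> Gh D [_ [[B oB <-] Bx BD]].
apply: (@filterS _ G FG _ _ BD); apply: Gh; exact: open_nbhs_nbhs.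
Qed.

Lemma ptws_eval_continuous (I : Type) (T : topologicalType) (i : I) :
  continuous (fun h : {ptws I -> T} => h i).
Proof.
move=> h; have /cvg_sup/(_ i) H : nbhs (h : {ptws I -> T}) --> h by [].
exact: cvg_trans (cvg_app (fun g : I -> T => g i) H) (@initial_continuous _ _
  (fun g : I -> T => g i) h).
Qed.

Lemma exists_fset (s : seq nat) : uniq s -> exists A : {fset nat}, perm_eq A s.
Proof.
by move=> us; exists (seq_fset tt s); rewrite -[X in perm_eq _ X]undup_id
  ?seq_fset_perm.
Qed.

(** * Archimedean and order facts for real or complex scalars; sparse subsequences; linear forms *)

Section Scalars.
Variable F : scalar_field.
Implicit Types (e : F).

(** Otherwise the naturals would have a least upper bound s, and s - 1 would bound them too.
    Nonnegative scalars are real, hence comparable with naturals. *)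
Lemma scalar_arch (a : F) : 0 <= a -> exists n : nat, a <= n%:R.
Proof.
move=> a0; apply: contrapT => /forallNP na.
have rn n : (n%:R : F) \is Num.real by exact: realn.
have ub : has_ubound [set (n%:R : F) | n in [set: nat]].
  exists a => _ [n _ <-]; have := na n.
  by case: (real_leP (ger0_real a0) (rn n)) => // /ltW.
have ge0 b : [set (n%:R : F) | n in [set: nat]] b -> 0 <= b by move=> [n _ <-].
have [|s [sub sleast]] := scalar_sup _ ge0 ub; first by exists 0, 0%N.
have s0 : 0 <= s by apply: sub; exists 0%N.
have : s <= s - 1.
  apply: sleast => _ [n _ <-]; rewrite lerBrDr natr1.
  by apply: sub; exists n.+1.
by rewrite lerDl oppr_ge0 real_leNgt ?ltr01 ?real1 ?real0.
Qed.

Lemma near_le_natr_mul (a e : F) : 0 <= a -> 0 < e ->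
  \forall n \near \oo, a <= n%:R * e.
Proof.
move=> a0 e0; have [n an] := scalar_arch (divr_ge0 a0 (ltW e0)).
exists n => // m /= nm; rewrite -ler_pdivrMr//; apply: le_trans an _.
by rewrite ler_nat.
Qed.

Lemma geo_half_sum N : \sum_(i < N) 2^-1 ^+ i <= 2 :> F.
Proof.
have h0 : 0 <= 2^-1 :> F by rewrite invr_ge0.
suff -> : \sum_(i < N) 2^-1 ^+ i = 2 - 2 * 2^-1 ^+ N :> F.
  by rewrite gerBl mulr_ge0 ?exprn_ge0.
elim: N => [|N IH]; first by rewrite big_ord0 expr0 mulr1 subrr.
rewrite big_ord_recr /= IH exprS mulVKf ?pnatr_eq0//.
rewrite -addrA; congr (_ + _).
by rewrite mulr_natl mulr2n opprD -addrA addNr addr0.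
Qed.

Lemma half_exp_gt0 n : 0 < 2^-1 ^+ n :> F.
Proof. by rewrite exprn_gt0// invr_gt0. Qed.

(** Nonnegativity supplies the comparability that the partial order of C does not give. *)
Lemma ltr_not_le (a b : F) : 0 <= a -> 0 <= b -> ~ a <= b -> b < a.
Proof.
by move=> a0 b0; case: (real_leP (ger0_real a0) (ger0_real b0)).
Qed.

(** Deterministic form of averaging over one random sign: one of two points is at least as large as
    their midpoint. *)
Lemma norm_midpoint (a b z : F) : a + b = 2 * z -> `|z| <= `|a| \/ `|z| <= `|b|.
Proof.
move=> abz; have ra := normr_real a; have rb := normr_real b.
have rz := normr_real z.
case: (real_leP rz ra) => za; [by left|right].
case: (real_leP rz rb) => // zb.
have := ltrD za zb; rewrite real_ltNge ?realD// => /negP[].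
by apply: le_trans (ler_normD a b); rewrite abz normrM ger0_norm// mulr_natl
  mulr2n.
Qed.

Lemma unit_phase (a : F) : exists2 t : F, `|t| <= 1 & t * a = `|a|.
Proof.
(* Since 0^-1 = 0, this phase is 0 at a = 0; hence the bound [|t| <= 1] instead of an equality. *)
exists (`|a| / a); have [->|a0] := eqVneq a 0.
- by rewrite normr0 mul0r normr0.
- by rewrite normrM normfV normr_id divff ?normr_eq0.
- by rewrite mulr0 normr0.
- by rewrite divfK.
Qed.

Lemma inv_succ_le e : 0 < e -> \forall n \near \oo, n.+1%:R^-1 <= e.
Proof.
move=> e0; apply: filterS (near_le_natr_mul (@ler01 F) e0) => n n1.
rewrite -div1r ler_pdivrMr// mulrC (le_trans n1)// ler_wpM2r ?(ltW e0)//.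
by rewrite ler_nat.
Qed.

Lemma subsequence_not_unbounded (a : nat -> F) (phi : nat -> nat) (l : F) :
  {homo phi : m n / (m < n)%N} -> (forall n, n%:R <= `|a n|) ->
  ~ \forall n \near \oo, `|l - a (phi n)| <= 1.
Proof.
move=> phiI an al.
have K0 : 0 <= `|l| + 1 + 1 by rewrite !addr_ge0.
have nK := near_le_natr_mul K0 (@ltr01 F).
near \oo => n.
have nl : `|l - a (phi n)| <= 1 by near: n.
have nl2 : `|l| + 1 + 1 <= n%:R * 1 by near: n.
suff : n%:R + 1 <= n%:R :> F by rewrite gerDl ler10.
rewrite mulr1 in nl2; apply: le_trans nl2; rewrite lerD2r.
apply: (@le_trans _ _ `|a (phi n)|).
  by apply: le_trans (an _); rewrite ler_nat homo_lt_ge.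
rewrite -[a (phi n)](subrK l) addrC (le_trans (ler_normD _ _))// lerD2l.
by rewrite distrC.
Unshelve. all: by end_near. Qed.

(* For each j all but one of the terms a (phi i) j are at most 2 ^- i: the
   exception is the first i whose threshold is at least lev j. *)
Lemma sparse_subsequence (J : Type) (lev : J -> nat) (a : nat -> J -> F) (C :
  F) :
  0 <= C ->
  (forall n j, 0 <= a n j <= C) ->
  (forall n e, 0 < e -> exists m, forall j, (m < lev j)%N -> a n j <= e) ->
  (forall m e, 0 < e ->
    \forall n \near \oo, forall j, (lev j <= m)%N -> a n j <= e) ->
  exists phi : nat -> nat, {homo phi : m n / (m < n)%N} /\
    forall N j, \sum_(i < N) a (phi i) j <= C + 2.
Proof.
move=> C0 aC tail low.
(* A pair is an index [p.1] with a level [p.2] above which that term is below 2^-k. [Q] makes each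
   later term small on all levels up to the earlier thresholds. *)
pose R k (p : nat * nat) := forall j, (p.2 < lev j)%N -> a p.1 j <= 2^-1 ^+ k.
pose Q k (p q : nat * nat) := (p.1 < q.1)%N /\
  forall j, (lev j <= p.2)%N -> a q.1 j <= 2^-1 ^+ k.
have [k f|f fP] := @ex_seq_pairwise _ (0, 0)%N R Q.
  have /filter_ex[n nP] : \forall n \near \oo, forall i, (i < k)%N -> ((f i).1
    < n)%N /\
      forall j, (lev j <= (f i).2)%N -> a n j <= 2^-1 ^+ k.
    apply: near_all_lt => i _.
    apply: filterI; first exact: (near_infty_gt (f i).1).
    exact: low (f i).2 _ (half_exp_gt0 k).
  have [m mP] := tail n _ (half_exp_gt0 k).
  by exists (n, m).
exists (fst \o f); split=> [|N j].
  by apply: homo_nat_lt => n i ltin; have [_ /(_ i ltin)[]] := fP n.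
apply: (@le_trans _ _ ((if [exists i : 'I_N, (lev j <= (f i).2)%N] then C else
  0)
    + \sum_(i < N) 2^-1 ^+ i)).
  elim: N => [|N IH]; first by rewrite !big_ord0 addr0; case: ifP.
  rewrite !big_ord_recr /= addrA.
  have aN : forall i : 'I_N, (lev j <= (f i).2)%N -> a (f N).1 j <= 2^-1 ^+ N.
    by move=> i ji; have [_ /(_ i (ltn_ord i))[_ ]] := fP N; exact.
  case: ifP IH => [/existsP[i ji] IH|/existsPn nex IH].
    rewrite ifT ?lerD ?(aN _ ji)//; apply/existsP.
    by exists (widen_ord (leqnSn N) i).
  have [jN|jN] := leqP (lev j) (f N).2.
    rewrite ifT; last by apply/existsP; exists ord_max.
    rewrite addrC -addrA lerD//; first by case/andP: (aC (f N).1 j).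
    by rewrite (le_trans IH)// add0r lerDl ltW ?half_exp_gt0.
  rewrite ifF; first by rewrite lerD//; exact: (proj1 (fP N)).
  apply/negbTE/existsPn => i; have := ltn_ord i; rewrite ltnS leq_eqVlt.
  case/predU1P => [iN|iN]; first by rewrite -ltnNge iN.
  by have := nex (Ordinal iN).
by rewrite lerD ?geo_half_sum//; case: ifP.
Qed.

Lemma scalarD (V : lmodType F) (f : V -> F) : scalar f ->
  forall x y : V, f (x + y) = f x + f y.
Proof. by move=> sf x y; have := sf 1 x y; rewrite scale1r mul1r. Qed.

Lemma scalar0 (V : lmodType F) (f : V -> F) : scalar f -> f 0 = 0.
Proof.
move=> sf; apply: (@addrI _ (f 0)).
by rewrite -(scalarD sf) !addr0.
Qed.

Lemma scalarZ (V : lmodType F) (f : V -> F) : scalar f ->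
  forall a (x : V), f (a *: x) = a * f x.
Proof. by move=> sf a x; rewrite -[a *: x]addr0 sf (scalar0 sf) addr0. Qed.

Lemma scalar_sum (V : lmodType F) (f : V -> F) : scalar f ->
  forall N (u : nat -> V), f (\sum_(i < N) u i) = \sum_(i < N) f (u i).
Proof.
move=> sf N u; elim: N => [|N IH]; first by rewrite !big_ord0 (scalar0 sf).
by rewrite !big_ord_recr /= (scalarD sf) IH.
Qed.

End Scalars.

(** * Null sequences in Schreier's space *)

Section SchreierSpace.
Variable F : scalar_field.
Implicit Types (x y : schreier F) (e C : F) (u v : nat -> schreier F).

Lemma schreier_val_sum N (u : nat -> schreier F) j :
  schreier_val (\sum_(i < N) u i) j = \sum_(i < N) schreier_val (u i) j.
Proof.
by elim: N => [|N IH]; rewrite ?big_ord0// !big_ord_recr /= -IH.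
Qed.

(** Beyond the support of a finitely supported approximant y, x coincides with x - y. *)
Lemma schreier_tail x e : 0 < e -> exists m, forall A, admissible A ->
  (forall n, n \in A -> (m <= n)%N) -> admissible_sum (schreier_val x) A <= e.
Proof.
move=> e0; have /asboolP/(_ e e0)[y /finite_fsetP[Y yY] xy] := valP x.
exists (\max_(n <- Y) n).+1 => A aA Am.
apply: le_trans (xy A aA); rewrite /admissible_sum big_seq [leRHS]big_seq.
apply: ler_sum => j jA; suff yj0 : y j = 0.
  by rewrite -[(schreier_val x - y) j]/(schreier_val x j - y j) yj0 subr0.
apply/eqP; apply: contraT => yj.
have jY : j \in Y by have : [set n | y n != 0] j by []; rewrite yY.
have := Am j jA; rewrite ltnNge; suff -> : (j <= \max_(n <- Y) n)%N by [].
by rewrite (big_fsetD1 j)//= leq_maxl.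
Qed.

Lemma schreier_coord_tail x e : 0 < e ->
  exists m, forall j, (m <= j)%N -> `|schreier_val x j| <= e.
Proof.
move=> e0; have [m mP] := schreier_tail x e0; exists m => j mj.
rewrite -admissible_sum1; apply: mP; first exact: admissible1.
by move=> n; rewrite inE => /eqP ->.
Qed.

Definition sup_null u := forall e, 0 < e ->
  \forall n \near \oo, forall j, `|schreier_val (u n) j| <= e.

Definition coord_null u := forall j e, 0 < e ->
  \forall n \near \oo, `|schreier_val (u n) j| <= e.

Lemma sup_null_subseq u (phi : nat -> nat) :
  {homo phi : m n / (m < n)%N} -> sup_null u -> sup_null (u \o phi).
Proof. by move=> /homo_lt_cvg H u0 e /u0; exact: H. Qed.

Lemma coord_null_subseq u (phi : nat -> nat) :
  {homo phi : m n / (m < n)%N} -> coord_null u -> coord_null (u \o phi).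
Proof. by move=> /homo_lt_cvg H u0 j e /u0 - /(_ j); exact: H. Qed.

(* The level of an admissible set is its cardinality: all elements of a large
   admissible set are large, and on a small one the sup norm controls the sum.
     *)
Lemma sup_null_c0_subsequence u C : 0 <= C -> (forall n, `|u n| <= C) ->
  sup_null u ->
  exists phi : nat -> nat, {homo phi : m n / (m < n)%N} /\
    forall N (t : nat -> F), (forall i, `|t i| <= 1) ->
      `|\sum_(i < N) t i *: u (phi i)| <= C + 2.
Proof.
move=> C0 uC u0.
pose J := {A : {fset nat} | admissible A}.
pose a n (A : J) := admissible_sum (schreier_val (u n)) (sval A).
have [||||phi [phiI phiP]] := @sparse_subsequence F J (fun A => #|` sval A|) a
  C.
- by [].
- move=> n [A aA]; rewrite admissible_sum_ge0 /=.
  exact: le_trans (schreier_norm_ge (u n) aA) (uC n).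
- move=> n e e0; have [m mP] := schreier_tail (u n) e0.
  exists m => -[A aA] /= mA; apply: mP => // k kA.
  by rewrite -ltnS (leq_trans mA)// aA.
- move=> m e e0.
  (* There are at most m summands; m + 1 keeps the denominator nonzero. *)
  have e1 : 0 < e / m.+1%:R by rewrite divr_gt0.
  apply: filterS (u0 _ e1) => n un [A aA] /= Am.
  apply: (@le_trans _ _ (\sum_(j <- A) e / m.+1%:R)).
    by apply: ler_sum => j _; exact: un.
  rewrite big_const_seq count_predT iter_addr_0 -[leLHS]mulr_natr mulrAC.
  rewrite ler_pdivrMr// ler_wpM2l ?(ltW e0)// ler_nat.
  by rewrite leqW.
exists phi; split=> // N t t1; apply: schreier_norm_le => A aA.
apply: le_trans (phiP N (exist _ A aA)).
have -> : admissible_sum (schreier_val (\sum_(i < N) t i *: u (phi i))) A =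
    \sum_(j <- A) `|\sum_(i < N) t i * schreier_val (u (phi i)) j|.
  apply: eq_bigr => j _.
  by rewrite (schreier_val_sum N (fun i => t i *: u (phi i))).
rewrite exchange_big /=; apply: ler_sum => j _.
apply: le_trans (ler_norm_sum _ _ _) _; apply: ler_sum => i _.
by rewrite normrM ler_piMl.
Qed.

Definition bounded_functional (f : schreier F -> F) :=
  exists2 K, 0 <= K & forall x, `|f x| <= K * `|x|.

Lemma dual_bounded (f : schreier F -> F) : scalar f -> continuous f ->
  bounded_functional f.
Proof.
move=> sf cf; pose g : {linear schreier F -> F} :=
  HB.pack f (GRing.isLinear.Build _ _ _ _ f sf).
have /linear_boundedP : bounded_near g (nbhs 0) by
  apply/linear_bounded_continuous.
move=> -[M [Mr HM]].
have M0 : M < `|M| + 1 by rewrite (le_lt_trans (real_ler_norm Mr))// ltrDl.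
by exists (`|M| + 1) => [|x]; [rewrite addr_ge0|exact: HM].
Qed.

(* If f stayed away from 0 along a coordinatewise null sequence, averages of a
   sparse subsequence would be uniformly null with constant value under f, so
   that they would span a copy of c0 on which f is unbounded. *)
Lemma coord_null_weakly_null (f : schreier F -> F) u C :
  scalar f -> bounded_functional f -> (forall n, `|u n| <= C) ->
  coord_null u -> forall e, 0 < e -> \forall n \near \oo, `|f (u n)| <= e.
Proof.
move=> sf [K K0 fK] uC u0 e e0; apply: contrapT.
have C0 : 0 <= C := le_trans (normr_ge0 _) (uC 0%N).
move=> /not_near_subsequence[psi [psiI psiP]].
have fe n : e < `|f (u (psi n))|.
  by apply: ltr_not_le; [exact: normr_ge0|exact: ltW|exact: psiP].
have fn0 n : f (u (psi n)) != 0 by rewrite -normr_gt0 (lt_trans e0).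
(* The factor has modulus at most 1, so the bounds on u persist, while f takes exactly the value e
   and its values add up without cancellation. *)
pose v n := (e / f (u (psi n))) *: u (psi n).
have c1 n : `|e / f (u (psi n))| <= 1.
  rewrite normrM normfV (gtr0_norm e0) ler_pdivrMr ?(lt_trans e0)//.
  by rewrite mul1r ltW.
have vC n : `|v n| <= C by rewrite normrZ (le_trans _ (uC (psi n)))// ler_piMl.
have fv n : f (v n) = e by rewrite (scalarZ sf) divfK.
have v0 : coord_null v.
  move=> j d d0; apply: filterS (coord_null_subseq psiI u0 j d0) => n /=.
  by apply: le_trans; rewrite normrM ler_piMl.
(* Here the level of a coordinate is the coordinate itself: tails of each term are small because it
   lies in S, and low coordinates are small because v is coordinatewise null. *)
have [||||phi [phiI phiP]] := @sparse_subsequence F nat id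
    (fun n j => `|schreier_val (v n) j|) C.
- by [].
- move=> n j; rewrite normr_ge0 /=.
  exact: le_trans (schreier_coord_le (v n) j) (vC n).
- move=> n d d0; have [m mP] := schreier_coord_tail (v n) d0.
  by exists m => j /ltnW; exact: mP.
- move=> m d d0.
  apply: filterS (near_all_lt (fun j (_ : (j < m.+1)%N) => v0 j _ d0)).
  by move=> n vn j; exact: vn.
pose z N := N.+1%:R^-1 *: \sum_(i < N.+1) v (phi i).
have zC N : `|z N| <= C.
  rewrite normrZ gtr0_norm ?invr_gt0// mulrC ler_pdivrMr//.
  apply: le_trans (ler_norm_sum _ _ _) _.
  have -> : C * N.+1%:R = \sum_(i < N.+1) C by rewrite sumr_const card_ord
    mulr_natr.
  by apply: ler_sum => i _; exact: vC.
have z0 : sup_null z.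
  move=> d d0.
  have C2 : 0 <= C + 2 by rewrite addr_ge0.
  apply: filterS (near_le_natr_mul C2 d0) => N Nd j.
  rewrite -[schreier_val _ j]/(N.+1%:R^-1 * schreier_val (\sum_(i < N.+1) v
    (phi i)) j).
  rewrite normrM gtr0_norm ?invr_gt0// mulrC ler_pdivrMr//.
  rewrite (schreier_val_sum _ (v \o phi)).
  apply: le_trans (ler_norm_sum _ _ _) _; apply: le_trans (phiP _ _) _.
  apply: le_trans Nd _; rewrite mulrC ler_wpM2l ?(ltW d0)// ler_nat.
  exact: leqnSn.
have fz N : f (z N) = e.
  rewrite (scalarZ sf) (scalar_sum sf _ (v \o phi)).
  rewrite (eq_bigr (fun=> e)) => [|i _]; last exact: fv.
  by rewrite sumr_const card_ord -[e *+ _]mulr_natl mulrA mulVf ?mul1r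
    ?pnatr_eq0.
have [th [_ thP]] := sup_null_c0_subsequence C0 zC z0.
(* The extra 1 turns N e <= K (C + 2), valid for every N, into a contradiction. *)
have B0 : 0 <= K * (C + 2) + 1 by rewrite addr_ge0// mulr_ge0// addr_ge0.
have /filter_ex[N] := near_le_natr_mul B0 e0.
have -> : N%:R * e = `|f (\sum_(i < N) 1 *: z (th i))|.
  rewrite (scalar_sum sf N (fun i => 1 *: z (th i))).
  rewrite (eq_bigr (fun=> e)) => [|i _]; last by rewrite scale1r fz.
  by rewrite sumr_const card_ord mulr_natl ger0_norm// mulrn_wge0 ?ltW.
move=> /le_trans/(_ (fK _)).
have th1 : forall i : nat, `|1 : F| <= 1 by rewrite normr1.
move=> /le_trans/(_ (ler_wpM2l K0 (thP N (fun=> 1) th1))).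
by rewrite gerDl ler10.
Qed.

End SchreierSpace.

(** * Uniform boundedness *)

Section Series.
Variable F : scalar_field.

(** Let s be the supremum of the absolute partial sums. Once one of them exceeds s - e, all later
    increments of the series are below e. *)
Lemma absolutely_bounded_series_cvg (a : nat -> F) (M : F) :
  (forall N, \sum_(i < N) `|a i| <= M) -> cvgn (fun N => \sum_(i < N) a i).
Proof.
move=> aM; apply: scalar_complete; apply: cauchy_exP => e e0.
pose S N := \sum_(i < N) `|a i|.
have S0 N : 0 <= S N by apply: sumr_ge0.
have [|||s [sub sleast]] := @scalar_sup F (range S).
- by exists (S 0%N), 0%N.
- by move=> _ [n _ <-].
- by exists M => _ [n _ <-]; exact: aM.
have sr : s \is Num.real.
  by apply/ger0_real/(le_trans (S0 0%N)); apply: sub; exists 0%N.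
have er := gtr0_real e0.
have [N sN] : exists N, s - e < S N.
  apply: contrapT => /forallNP nN.
  have : s <= s - e.
    apply: sleast => _ [n _ <-].
    rewrite real_leNgt ?rpredB ?(ger0_real (S0 n))//.
    by apply/negP; exact: nN.
  by rewrite lerDl oppr_ge0 real_leNgt ?real0// e0.
exists (\sum_(i < N) a i); exists N => // n /= Nn.
have sumE (f : nat -> F) :
    \sum_(i < n) f i - \sum_(i < N) f i = \sum_(i < n - N) f (N + i)%N.
  have -> : \sum_(i < n) f i = \sum_(i < N + (n - N)) f i by rewrite subnKC.
  by rewrite big_split_ord /= addrAC subrr add0r.
rewrite -ball_normE /= distrC sumE.
apply: (@le_lt_trans _ _ (S n - S N)).
  by rewrite /S (sumE (fun i => `|a i|)) ler_norm_sum.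
rewrite ltrBlDr -ltrBlDl (le_lt_trans _ sN)//.
by rewrite lerB//; apply: sub; exists n.
Qed.

Lemma limit_norm_le (a : nat -> F) (l b M : F) : a @ \oo --> l ->
  (\forall n \near \oo, `|a n - b| <= M) -> `|l - b| <= M.
Proof.
move=> al aM; apply/ler_addgt0Pr => e e0.
move/cvgrPdist_le: al => /(_ _ e0) al.
near \oo => n.
have ln : `|l - a n| <= e by near: n.
have nM : `|a n - b| <= M by near: n.
rewrite -(subrK (a n) l) -addrA addrC.
by rewrite (le_trans (ler_normD _ _))// lerD.
Unshelve. all: by end_near. Qed.

Lemma series_functional (V : lmodType F) (g : nat -> V -> F) :
  (forall i, scalar (g i)) ->
  (forall x, exists M : F, forall N, \sum_(i < N) `|g i x| <= M) ->
  exists2 f : V -> F, scalar f &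
    forall x, (fun N => \sum_(i < N) g i x) @ \oo --> f x.
Proof.
move=> sg gM.
exists (fun x => lim ((fun N => \sum_(i < N) g i x) @ \oo)) => [a x y|x];
  last first.
  have [M xM] := gM x.
  exact: (absolutely_bounded_series_cvg (a := fun i => g i x) xM).
have [M xM] := gM x; have [M' yM] := gM y.
apply/cvg_lim => //.
have -> : (fun N => \sum_(i < N) g i (a *: x + y)) =
    (fun N => a * \sum_(i < N) g i x + \sum_(i < N) g i y).
  apply/funext => N; rewrite mulr_sumr -big_split; apply: eq_bigr => i _.
  exact: sg.
apply: cvgD; last exact: (absolutely_bounded_series_cvg (a := fun i => g i y)
  yM).
by apply: cvgMr; exact: (absolutely_bounded_series_cvg (a := fun i => g i x)
  xM).
Qed.

Lemma geo_quarter_sum N : \sum_(i < N) 4^-1 ^+ i <= 4 / 3 :> F.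
Proof.
suff -> : \sum_(i < N) 4^-1 ^+ i = 4 / 3 - 4 / 3 * 4^-1 ^+ N :> F.
  by rewrite gerBl !mulr_ge0 ?exprn_ge0 ?invr_ge0.
elim: N => [|N IH]; first by rewrite big_ord0 expr0 mulr1 subrr.
by rewrite big_ord_recr /= IH exprS; field.
Qed.

Lemma bounded_functional_continuous (f : schreier F -> F) :
  scalar f -> bounded_functional f -> continuous f.
Proof.
move=> sf [K K0 fK]; pose g : {linear schreier F -> F} :=
  HB.pack f (GRing.isLinear.Build _ _ _ _ f sf).
apply: (@linear_bounded_continuous _ _ _ g).1.
apply/linear_boundedP; exists K; split; first exact: ger0_real.
by move=> M KM x; apply: le_trans (fK x) _; rewrite ler_wpM2r// ltW.
Qed.

Lemma admissible_functional (t : nat -> F) (A : {fset nat}) : admissible A ->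
  (forall j, `|t j| <= 1) ->
  let g := fun x : schreier F => \sum_(j <- A) t j * schreier_val x j in
  scalar g /\ forall x, `|g x| <= `|x|.
Proof.
move=> aA t1; split=> [a x y|x].
  rewrite mulr_sumr -big_split; apply: eq_bigr => j _.
  rewrite -[schreier_val (_ + _) j]/(a * schreier_val x j + schreier_val y j).
  by rewrite /= mulrDr mulrCA.
apply: le_trans (schreier_norm_ge x aA); apply: le_trans (ler_norm_sum _ _ _) _.
by apply: ler_sum => j _; rewrite normrM ler_piMl.
Qed.

(** Some admissible set realizes at least half of the norm, and the functional sums the coordinates
    on it with their conjugate phases. The factor 1/2 spares having to attain the supremum. *)
Lemma half_norming_functional (x : schreier F) : exists g : schreier F -> F,
  [/\ scalar g, forall y, `|g y| <= `|y| & `|x| / 2 <= `|g x|].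
Proof.
have [->|x0] := eqVneq x 0.
  exists (fun=> 0); split=> [a y z|y|]; rewrite ?normr0 ?mul0r//.
  by rewrite mulr0 addr0.
have [A aA xA] : exists2 A, admissible A &
    `|x| / 2 <= admissible_sum (schreier_val x) A.
  apply: contrapT => nA; have : `|x| <= `|x| / 2.
    apply: schreier_norm_le => A aA.
    have rs := ger0_real (admissible_sum_ge0 (schreier_val x) A).
    rewrite real_leNgt ?realM ?normr_real ?realV ?realn//.
    by apply/negP => /ltW lt; apply: nA; exists A.
  by rewrite ler_pdivlMr// ger_pMr ?normr_gt0// real_leNgt ?realn// ltr1n.
pose t j := `|schreier_val x j| / schreier_val x j.
have t1 j : `|t j| <= 1.
  rewrite normrM normfV normr_id.
  have [->|xj] := eqVneq (schreier_val x j) 0; first by rewrite normr0 mul0r.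
  by rewrite divff ?normr_eq0.
have [sg gx] := admissible_functional aA t1.
exists (fun x => \sum_(j <- A) t j * schreier_val x j); split=> //.
suff -> : \sum_(j <- A) t j * schreier_val x j = admissible_sum (schreier_val
  x) A.
  by rewrite ger0_norm// admissible_sum_ge0.
apply: eq_bigr => j _; rewrite /t.
have [->|xj] := eqVneq (schreier_val x j) 0; first by rewrite normr0 mulr0.
by rewrite divfK.
Qed.

(* Sokal's gliding hump: the sign of the k-th term is chosen so that it cannot
   be cancelled by the earlier ones, and the geometric tail is too small to
   cancel it. *)
Lemma pointwise_bounded_norm_bounded (A : set (schreier F)) :
  (forall f : schreier F -> F, scalar f -> continuous f ->
    exists K, forall x, A x -> `|f x| <= K) ->
  exists2 C, 0 <= C & forall x, A x -> `|x| <= C.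
Proof.
move=> fA; apply: contrapT => /forall2NP nC.
have q0 n : 0 <= 4^-1 ^+ n :> F by rewrite exprn_ge0// invr_ge0.
(* Origin of 6: the hump contributes 4^-n |x| / 2, and the later terms take away at most 4^-(n+1)
   (4/3) |x| = 4^-n |x| / 3. What remains is 4^-n |x| / 6 >= n. *)
have big n : exists2 x, A x & n%:R * 6 * 4 ^+ n <= `|x|.
  have n0 : 0 <= n%:R * 6 * 4 ^+ n :> F by rewrite !mulr_ge0 ?exprn_ge0.
  have [//|/existsNP[x /not_implyP[Ax xn]]] := nC (n%:R * 6 * 4 ^+ n).
  by exists x => //; apply/ltW/ltr_not_le.
pose X : Type := (schreier F -> F) * schreier F.
pose G (s : seq X) (p : X) := [/\ scalar p.1, forall y, `|p.1 y| <= `|y|,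
  A p.2, (size s)%:R * 6 * 4 ^+ size s <= `|p.2| &
  4^-1 ^+ size s * (`|p.2| / 2) <=
    `|\sum_(i < size s) 4^-1 ^+ i * (nth p s i).1 p.2 + 4^-1 ^+ size s * p.1
      p.2|].
have [s|p pG] := @ex_dependent_seq X G.
  have [u Au un] := big (size s).
  have [g [sg gle gu]] := half_norming_functional u.
  pose c := \sum_(i < size s) 4^-1 ^+ i * (nth (g, u) s i).1 u.
  pose d := 4^-1 ^+ size s * g u.
  have dge : 4^-1 ^+ size s * (`|u| / 2) <= `|d|.
    by rewrite normrM (ger0_norm (q0 _)) ler_wpM2l.
  have E h : \sum_(i < size s) 4^-1 ^+ i * (nth (h, u) s i).1 u = c.
    by apply: eq_bigr => i _; rewrite (set_nth_default (g, u)).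
  have [cd|cd] : `|d| <= `|c + d| \/ `|d| <= `|c - d|.
    (* d is the midpoint of c + d and -(c - d), so either g or its opposite leaves a sum of size at
       least |d|. *)
    have /norm_midpoint[|] : c + d + - (c - d) = 2 * d by ring.
      by left.
    by rewrite normrN; right.
  - exists (g, u); split=> //=.
    exact: le_trans dge cd.
  - exists (fun y => - g y, u); split=> //=.
    + by move=> a x y; rewrite sg opprD mulrN.
    + by move=> y; rewrite normrN.
    + by rewrite E mulrN; exact: le_trans dge cd.
have {}pG n : [/\ scalar (p n).1, forall y, `|(p n).1 y| <= `|y|,
    A (p n).2, n%:R * 6 * 4 ^+ n <= `|(p n).2| &
    4^-1 ^+ n * (`|(p n).2| / 2) <=
      `|\sum_(i < n.+1) 4^-1 ^+ i * (p i).1 (p n).2|].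
  have := pG n; rewrite /G size_mkseq => -[? ? ? ? le]; split=> //.
  rewrite big_ord_recr /=; apply: le_trans le _.
  rewrite (eq_bigr (fun i : 'I_n => 4^-1 ^+ i * (p i).1 (p n).2))// => i _.
  by rewrite nth_mkseq.
pose g i y := 4^-1 ^+ i * (p i).1 y.
have gle i y : `|g i y| <= 4^-1 ^+ i * `|y|.
  rewrite normrM (ger0_norm (q0 _)) ler_wpM2l//.
  by have [_ + _ _ _] := pG i; exact.
have [||f sf fg] := @series_functional (schreier F) g.
- move=> i a x y; have [sg _ _ _ _] := pG i.
  by rewrite /g sg mulrDr mulrCA.
- move=> x; exists (4 / 3 * `|x|) => N.
  apply: (@le_trans _ _ (\sum_(i < N) 4^-1 ^+ i * `|x|)).
    by apply: ler_sum => i _; exact: gle.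
  by rewrite -mulr_suml ler_wpM2r// geo_quarter_sum.
have tail n x : `|f x - \sum_(i < n) g i x| <= 4^-1 ^+ n * (4 / 3 * `|x|).
  apply: limit_norm_le (fg x) _; exists n => // N /= nN.
  have -> : \sum_(i < N) g i x = \sum_(i < n + (N - n)) g i x by rewrite subnKC.
  rewrite big_split_ord /= addrAC subrr add0r.
  apply: le_trans (ler_norm_sum _ _ _) _.
  apply: (@le_trans _ _ (\sum_(i < N - n) 4^-1 ^+ n * (4^-1 ^+ i * `|x|))).
    by apply: ler_sum => i _; apply: le_trans (gle _ _) _; rewrite exprD mulrA.
  by rewrite -mulr_sumr -mulr_suml ler_wpM2l// ler_wpM2r// geo_quarter_sum.
have bf : bounded_functional f.
  exists (4 / 3) => [//|x]; have := tail 0%N x.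
  by rewrite big_ord0 subr0 expr0 mul1r.
have [K fK] := fA f sf (bounded_functional_continuous sf bf).
have Kge n : n%:R <= K.
  have [_ _ Ap pn pk] := pG n; apply: le_trans (fK _ Ap).
  have := tail n.+1 (p n).2.
  set x := (p n).2 in Ap pn pk *; set h := \sum_(i < n.+1) _ => fh.
  have -> : n%:R = 4^-1 ^+ n * (n%:R * 6 * 4 ^+ n / 6) :> F.
    by rewrite exprVn; field; rewrite expf_neq0//.
  apply: (@le_trans _ _ (4^-1 ^+ n * (`|x| / 6))).
    by rewrite ler_wpM2l// ler_wpM2r ?invr_ge0.
  have hx : 4^-1 ^+ n * (`|x| / 2) <= `|f x| + 4^-1 ^+ n.+1 * (4 / 3 * `|x|).
    apply: le_trans pk _; rewrite -[X in `|X| <= _](subrKC (f x)).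
    by rewrite (le_trans (ler_normD _ _))// lerD2l distrC.
  have -> : 4^-1 ^+ n * (`|x| / 6) =
      4^-1 ^+ n * (`|x| / 2) - 4^-1 ^+ n.+1 * (4 / 3 * `|x|).
    by rewrite exprS; field.
  by rewrite lerBlDr.
have K0 : 0 <= K := Kge 0%N.
have /filter_ex[n] := near_le_natr_mul (addr_ge0 K0 ler01) (@ltr01 F).
rewrite mulr1 => /le_trans/(_ (Kge n)).
by rewrite gerDl ler10.
Qed.
End Series.

(** * Multilinear forms along sup-null sequences *)

Section Multilinear.
Variable F : scalar_field.

Section Signs.
Variables (V : lmodType F) (T : nat -> V -> F) (x : nat -> V).
Hypothesis scalarT : forall i, scalar (T i).

(* The mean over all signs of the right-hand side, without the norm, is the
   left-hand side. *)
Lemma sign_decoupling N (c : F) : exists eps : nat -> F,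
  (forall i, `|eps i| = 1) /\
  `|c + \sum_(i < N) T i (x i)| <=
    `|c + \sum_(i < N) eps i * T i (\sum_(l < N) eps l *: x l)|.
Proof.
elim: N c => [|N IH] c.
  by exists (fun=> 1); split=> [i|]; rewrite ?normr1// !big_ord0.
(* The free constant c absorbs the last diagonal term. *)
have [eps [eps1 epsP]] := IH (c + T N (x N)).
pose X := \sum_(l < N) eps l *: x l; rewrite -/X in epsP.
pose a s := c + \sum_(i < N) eps i * T i (X + s *: x N) + s * T N (X + s *: x
  N).
have aE s : a s = c + \sum_(i < N) eps i * T i X + s * T N X + s * s * T N (x N)
    + s * \sum_(i < N) eps i * T i (x N).
  rewrite /a (scalarD (scalarT N)) (scalarZ (scalarT N)).
  rewrite (_ : \sum_(i < N) _ = \sum_(i < N) eps i * T i X +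
    s * \sum_(i < N) eps i * T i (x N)); first by ring.
  rewrite mulr_sumr -big_split; apply: eq_bigr => i _ /=.
  by rewrite (scalarD (scalarT i)) (scalarZ (scalarT i)); ring.
have [s s1 sP] : exists2 s : F, `|s| = 1 &
    `|c + T N (x N) + \sum_(i < N) eps i * T i X| <= `|a s|.
  (* Adding the two signs cancels the terms linear in s and keeps the quadratic one, as s * s =
     1. *)
  have : a 1 + a (-1) = 2 * (c + T N (x N) + \sum_(i < N) eps i * T i X).
    by rewrite !aE; ring.
  by move=> /norm_midpoint[h|h]; [exists 1|exists (-1)];
    rewrite ?normrN ?normr1.
exists (fun i => if (i < N)%N then eps i else s); split=> [i|];
  first by case: ifP.
have -> : c + \sum_(i < N.+1) T i (x i) = c + T N (x N) + \sum_(i < N) T i (x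
  i).
  by rewrite big_ord_recr /=; ring.
have epsE (W : nmodType) (h : F -> nat -> W) :
    \sum_(i < N.+1) h (if (i < N)%N then eps i else s) i =
    \sum_(i < N) h (eps i) i + h s N.
  rewrite big_ord_recr /= ltnn; congr (_ + _).
  by apply: eq_bigr => i _; rewrite ltn_ord.
rewrite (epsE V (fun e l => e *: x l)) -/X.
rewrite (epsE F (fun e i => e * T i (X + s *: x N))) addrA.
exact: le_trans epsP sP.
Qed.

End Signs.

Section Forms.
Variables (E : completeNormedModType F) (k : nat).
Implicit Types (x : 'I_k -> E).

Lemma multilinear_scale (M : ('I_k -> E) -> F) : multilinear_form M ->
  forall a x, M (fun i => a *: x i) = a ^+ k * M x.
Proof.
move=> Mm a x.
have H s : uniq s ->
    M (fun i => if i \in s then a *: x i else x i) = a ^+ size s * M x.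
  elim: s => [_|j s IH /andP[js us]]; first by rewrite expr0 mul1r.
  pose y i := if i \in s then a *: x i else x i.
  have -> : (fun i => if i \in j :: s then a *: x i else x i) =
      dfwith y j (a *: x j).
    apply/funext => i; have [<-|ij] := eqVneq j i.
      by rewrite dfwithin mem_head.
    by rewrite dfwithout// inE eq_sym (negbTE ij).
  rewrite (scalarZ (Mm y j)).
  have -> : dfwith y j (x j) = y.
    apply/funext => i; have [<-|ij] := eqVneq j i.
      by rewrite dfwithin /y (negbTE js).
    by rewrite dfwithout.
  by rewrite /= (IH us) exprS mulrA.
have := H (enum 'I_k) (enum_uniq _); rewrite size_enum_ord => <-.
by congr (M _); apply/funext => i; rewrite mem_enum.
Qed.

(** Continuity at 0 bounds M on a small polyball, and homogeneity of degree k rescales the bound to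
    radius B. The value at 0 stays in the bound because it may be nonzero when k = 0. *)
Lemma multilinear_bounded (M : {ptws 'I_k -> E} -> F) :
  multilinear_form M -> continuous M ->
  forall B : F, 0 <= B -> exists2 K : F, 0 <= K &
    forall x, (forall i, `|x i| <= B) -> `|M x| <= K.
Proof.
move=> Mm Mc B B0.
pose D := `|M (fun=> 0)| + 1.
have D0 : 0 <= D by rewrite addr_ge0.
have [n nP] : exists n : nat, forall x, (forall i, `|x i| <= n.+1%:R^-1) -> `|M
  x| <= D.
  apply: contrapT => /forallNP nD.
  have /choice[x xP] n : exists x, (forall i, `|x i| <= n.+1%:R^-1) /\ ~ `|M x|
    <= D.
    by have /existsNP[x /not_implyP[? ?]] := nD n; exists x.
  have x0 : {ptws, x @ \oo --> (fun=> 0 : E)}.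
    apply: ptws_cvg => i; apply/cvgrPdist_le => e e0.
    apply: filterS (near_le_natr_mul (@ler01 F) e0) => n n1.
    rewrite /= sub0r normrN (le_trans (proj1 (xP n) i))//.
    rewrite -div1r ler_pdivrMr// mulrC (le_trans n1)// ler_wpM2r ?(ltW e0)//.
    by rewrite ler_nat.
  have /cvgrPdist_le/(_ 1 ltr01)/filter_ex[n] : M (x n) @[n --> \oo] --> M
    (fun=> 0).
    by apply: cvg_comp x0 _; exact: Mc.
  apply: contra_not (proj2 (xP n)) => Mx.
  rewrite -[M (x n)](subrK (M (fun=> 0))) addrC (le_trans (ler_normD _ _))//.
  by rewrite lerD2l distrC.
pose c : F := n.+1%:R^-1 / (B + 1).
have B1 : 0 < B + 1 by rewrite ltr_wpDl.
have c0 : 0 < c by rewrite divr_gt0 ?invr_gt0.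
exists (c ^- k * D) => [|x xB]; first by rewrite mulr_ge0// invr_ge0 exprn_ge0
  ?ltW.
have := nP (fun i => c *: x i); rewrite (multilinear_scale Mm) normrM normrX.
rewrite (gtr0_norm c0) -ler_pdivlMl ?exprn_gt0//; apply=> i.
rewrite normrZ gtr0_norm// -mulrA ger_pMr ?invr_gt0// ler_pdivrMl// mulr1.
by rewrite (le_trans (xB i))// lerDl.
Qed.

(* Replacing the entries v i at all but one position by common signed sums. *)
Lemma multilinear_diagonal_le (M : ('I_k -> E) -> F) (v : nat -> E) (B K : F) N
  :
  multilinear_form M ->
  (forall t : nat -> F, (forall i, `|t i| <= 1) ->
    `|\sum_(i < N) t i *: v i| <= B) ->
  (forall x, (forall i, `|x i| <= B) -> `|M x| <= K) ->
  forall j s (x : 'I_k -> E) (t : nat -> F), uniq (j :: s) ->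
    (forall p, `|x p| <= B) -> (forall i, `|t i| <= 1) ->
    `|\sum_(i < N) t i * M (fun p => if p \in j :: s then v i else x p)| <= K.
Proof.
move=> Mm vB MK j; elim=> [|q s IH] x t us xB t1.
  have -> : \sum_(i < N) t i * M (fun p => if p \in [:: j] then v i else x p) =
      M (dfwith x j (\sum_(i < N) t i *: v i)).
    rewrite (scalar_sum (Mm x j) N (fun i => t i *: v i));
      apply: eq_bigr => i _.
    rewrite (scalarZ (Mm x j)); congr (_ * M _); apply/funext => p.
    rewrite inE; have [->|pj] := eqVneq p j; first by rewrite dfwithin.
    by rewrite dfwithout// eq_sym.
  apply: MK => p; have [->|pj] := eqVneq p j; first by rewrite dfwithin vB.
  by rewrite dfwithout// eq_sym.
have [/= qj qs us'] : [/\ q != j, q \notin s & uniq (j :: s)].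
  move: us; rewrite /= inE negb_or => /andP[/andP[jq ->] /andP[-> ->]].
  by rewrite eq_sym jq.
pose y i p := if p \in j :: s then v i else x p.
have -> : \sum_(i < N) t i * M (fun p => if p \in [:: j, q & s] then v i else x
  p) =
    \sum_(i < N) t i * M (dfwith (y i) q (v i)).
  apply: eq_bigr => i _; congr (_ * M _); apply/funext => p.
  have [->|pq] := eqVneq p q; first by rewrite dfwithin !inE eqxx orbT.
  by rewrite dfwithout ?(eq_sym q)// /y !inE (negbTE pq).
(* Decoupling slot q puts the common signed sum there and moves the signs into the coefficients t,
   so one slot fewer carries the running index. *)
have [i|eps [eps1]] := @sign_decoupling E (fun i z => t i * M (dfwith (y i) q
  z)) v _ N 0.
  by move=> a z w; rewrite (Mm (y i) q) mulrDr mulrCA.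
rewrite !add0r; pose w := \sum_(l < N) eps l *: v l; rewrite -/w => /le_trans;
  apply.
have wB : `|w| <= B by apply: vB => i; rewrite eps1.
have := IH (dfwith x q w) (fun i => eps i * t i) us'.
have -> : \sum_(i < N) eps i * t i *
      M (fun p => if p \in j :: s then v i else dfwith x q w p) =
    \sum_(i < N) eps i * (t i * M (dfwith (y i) q w)).
  apply: eq_bigr => i _; rewrite -mulrA; congr (_ * (_ * M _));
    apply/funext => p.
  have [->|pq] := eqVneq p q; first by rewrite !dfwithin inE (negbTE qj)
    (negbTE qs).
  by rewrite !dfwithout ?(eq_sym q).
apply=> [p|i]; last by rewrite normrM eps1 mul1r.
have [->|pq] := eqVneq p q; first by rewrite dfwithin.
by rewrite dfwithout ?(eq_sym q).
Qed.

End Forms.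

(** If the values stayed at least e along a subsequence, phases would make N of them add up to at
    least N e, against a bound independent of N. The fixed entries x serve the expansion of M at u =
    l + v. *)
Lemma mixed_form_null k (M : {ptws 'I_k -> schreier F} -> F) (v : nat ->
  schreier F) (C : F)
    j s (x : 'I_k -> schreier F) :
  multilinear_form M -> continuous M -> 0 <= C -> (forall n, `|v n| <= C) ->
  sup_null v -> uniq (j :: s) ->
  forall e, 0 < e -> \forall n \near \oo,
    `|M (fun p => if p \in j :: s then v n else x p)| <= e.
Proof.
move=> Mm Mc C0 vC v0 us e e0; apply: contrapT.
move=> /not_near_subsequence[psi [psiI psiP]].
have [phi [_ phiP]] :=
  sup_null_c0_subsequence C0 (fun n => vC (psi n)) (sup_null_subseq psiI v0).
(* A single radius has to cover both the signed sums and the fixed entries. *)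
pose B := C + 2 + \sum_p `|x p|.
have S0 : 0 <= \sum_p `|x p| by apply: sumr_ge0.
have C2 : 0 <= C + 2 by rewrite addr_ge0.
have [K K0 MK] := multilinear_bounded Mm Mc (addr_ge0 C2 S0).
pose b i := M (fun p => if p \in j :: s then v (psi (phi i)) else x p).
have be i : e <= `|b i|.
  by apply/ltW/ltr_not_le; [exact: normr_ge0|exact: ltW|exact: psiP].
have /choice[t tP] i : exists t : F, `|t| <= 1 /\ t * b i = `|b i|.
  by have [t ? ?] := unit_phase (b i); exists t.
have bK N : N%:R * e <= K.
  apply: (@le_trans _ _ `|\sum_(i < N) t i * b i|).
    rewrite (eq_bigr (fun i : 'I_N => `|b i|)) => [|i _];
      last by have [] := tP i.
    rewrite ger0_norm ?sumr_ge0//.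
    rewrite mulr_natl -[N in e *+ N]card_ord -sumr_const.
    by apply: ler_sum => i _; exact: be.
  have H := @multilinear_diagonal_le _ k M (v \o psi \o phi) B K N Mm _ MK j s
    x t us.
  apply: H => [u u1|p|i]; last by have [] := tP i.
    by apply: le_trans (phiP N u u1) _; rewrite lerDl.
  by rewrite /B (bigD1 p)//= addrCA lerDl addr_ge0// sumr_ge0.
have /filter_ex[N] := near_le_natr_mul (addr_ge0 K0 ler01) e0.
by move=> /le_trans/(_ (bK N)); rewrite gerDl ler10.
Qed.

Definition sup_converges (u : nat -> schreier F) (l : schreier F) := sup_null
  (fun n => u n - l).

Lemma sup_converges_P_converges (u : nat -> schreier F) (l : schreier F) (C :
  F) :
  (forall n, `|u n| <= C) -> sup_converges u l -> P_converges u l.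
Proof.
move=> uC ul k P k0 [M [Mm Mc MP]]; pose v n := u n - l.
have C0 : 0 <= C := le_trans (normr_ge0 _) (uC 0%N).
have vC n : `|v n| <= C + `|l| by rewrite (le_trans (ler_normB _ _))// lerD2r.
have D0 : 0 <= C + `|l| by rewrite addr_ge0.
(* Slots in s' hold v, the remaining slots in s still hold u, and all others hold l. Splitting u = l
   + v one slot at a time leaves M at l plus terms with at least one v. *)
pose h (s s' : seq 'I_k) n := M (fun p => if p \in s' then v n else
  if p \in s then u n else l).
have H (s s' : seq 'I_k) : uniq (s ++ s') ->
    h s s' n @[n --> \oo] --> (if s' is [::] then M (fun=> l) else 0).
  elim: s s' => [|q s IH] s'.
    case: s' => [|j s'] us; first by rewrite /h /=; exact: (@cvg_cst F).
    apply/cvgr0Pnorm_le => e e0.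
    exact: (mixed_form_null (fun=> l) Mm Mc D0 vC ul us e0).
  move=> /= /andP[]; rewrite mem_cat negb_or => /andP[qs qs'] us.
  have us2 : uniq (s ++ (q :: s')).
    by rewrite -cat1s uniq_catCA /= mem_cat negb_or qs qs'.
  have -> : h (q :: s) s' = (fun n => h s s' n + h s (q :: s') n).
    apply/funext => n.
    pose y p := if p \in s' then v n else if p \in s then u n else l.
    have hE (z : schreier F) (g : 'I_k -> schreier F) : g q = z ->
        (forall p, p != q -> g p = y p) -> g = dfwith y q z.
      move=> gq gy; apply/funext => p; have [->|pq] := eqVneq p q.
        by rewrite dfwithin.
      by rewrite dfwithout ?(eq_sym q)// gy.
    have -> : h (q :: s) s' n = M (dfwith y q (u n)).
      congr (M _); apply: hE => [|p pq]; first by rewrite (negbTE qs') mem_head.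
      by rewrite inE (negbTE pq).
    have -> : h s s' n = M (dfwith y q l).
      by congr (M _); apply: hE => //; rewrite (negbTE qs') (negbTE qs).
    have -> : h s (q :: s') n = M (dfwith y q (v n)).
      congr (M _); apply: hE => [|p pq]; first by rewrite mem_head.
      by rewrite inE (negbTE pq).
    by rewrite -(scalarD (Mm y q)) /v addrC subrK.
  rewrite -[X in _ --> X]addr0; apply: cvgD; first exact: IH us.
  exact: IH us2.
rewrite MP; have := H (enum 'I_k) [::]; rewrite cats0 => /(_ (enum_uniq _)).
suff -> : h (enum 'I_k) [::] = (fun n => P (u n)) by [].
apply/funext => n; rewrite MP; congr (M _); apply/funext => p.
by rewrite mem_enum.
Qed.

End Multilinear.

(** * Humps and Banach-Saks sets *)

Section BanachSaks.
Variable F : scalar_field.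
(** Bolzano-Weierstrass for scalars, established for R and C at the end; it is used to extract
    coordinatewise limits. *)
Hypothesis ball_precompact : forall B : F, precompact [set a : F | `|a| <= B].
Implicit Types (u v w : nat -> schreier F) (e C d : F).

(** Tychonoff's theorem replaces the diagonal argument. The n-th condition involves only coordinates
    below n, hence is a neighbourhood in the pointwise topology. *)
Lemma coord_convergent_subsequence u C : (forall n, `|u n| <= C) ->
  exists phi : nat -> nat, {homo phi : m n / (m < n)%N} /\
    exists y : nat -> F, forall j e, 0 < e ->
      \forall n \near \oo, `|schreier_val (u (phi n)) j - y j| <= e.
Proof.
move=> uC; have [U BU [cU _]] := ball_precompact C.
have [|y [_ uy]] := @tychonoff nat (fun=> F) (fun=> U) (fun=> cU)
    ((fun n => schreier_val (u n)) @ \oo).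
  exists 0%N => // n _ j; apply: BU.
  exact: le_trans (schreier_coord_le _ _) (uC n).
have [n|phi [phiI phiP]] := @cluster_subsequence {ptws nat -> F} _ _
    (fun n (z : nat -> F) => forall j, (j < n)%N -> `|z j - y j| <= n.+1%:R^-1)
      uy.
  apply: (@near_all_lt _ (nbhs (y : {ptws nat -> F})) (nbhs_filter _)) => j _.
  apply: (@proj_continuous nat (fun=> F) j y [set a : F | `|a - y j| <=
    n.+1%:R^-1]).
  have n0 : 0 < n.+1%:R^-1 :> F by rewrite invr_gt0.
  apply/nbhs_normP; exists n.+1%:R^-1 => //= a.
  by rewrite /ball_ /= distrC => /ltW.
exists phi; split=> //; exists y => j e e0.
apply: filterS2 (near_infty_gt j) (inv_succ_le e0) => n jn ne.
exact: le_trans (phiP n j jn) ne.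
Qed.

Lemma cesaro_mean (b : nat -> F) (y : F) :
  (forall e, 0 < e -> \forall n \near \oo, `|b n - y| <= e) ->
  forall e, 0 < e ->
    \forall n \near \oo, `|n.+1%:R^-1 * \sum_(i < n.+1) b i - y| <= e.
Proof.
move=> b_y e e0; have e2 : 0 < e / 2 by rewrite divr_gt0.
have [N _ NP] := b_y _ e2.
pose K := \sum_(i < N) `|b i - y|.
have K0 : 0 <= K by apply: sumr_ge0.
have sumK n : \sum_(i < n) `|b i - y| <= K + n%:R * (e / 2).
  elim: n => [|n IH]; first by rewrite big_ord0 mul0r addr0.
  rewrite big_ord_recr /=; have [Nn|nN] := leqP N n.
    by rewrite -natr1 mulrDl mul1r addrA lerD// NP.
  rewrite -(big_ord_recr n (fun i => `|b i - y|)) /=.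
  apply: (@le_trans _ _ K); last by rewrite lerDl mulr_ge0// ltW.
  rewrite /K -(subnKC nN) big_split_ord /= lerDl.
  exact: sumr_ge0.
apply: filterS (near_le_natr_mul K0 e2) => n nK.
have -> : n.+1%:R^-1 * \sum_(i < n.+1) b i - y =
    n.+1%:R^-1 * \sum_(i < n.+1) (b i - y).
  rewrite big_split /= sumr_const card_ord mulrDr; congr (_ + _).
  by rewrite mulNrn mulrN -[y *+ _]mulr_natl mulKf ?pnatr_eq0.
rewrite normrM ger0_norm ?invr_ge0// mulrC ler_pdivrMr//.
apply: le_trans (ler_norm_sum _ _ _) _; apply: le_trans (sumK _) _.
rewrite [leRHS](_ : _ = n.+1%:R * (e / 2) + n.+1%:R * (e / 2)); last by field.
rewrite lerD2r (le_trans nK)// ler_wpM2r ?(ltW e2)// ler_nat.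
exact: leqnSn.
Qed.

(** Smallness is needed in both directions: entries of the other w_k at j_n for norms of sums, and
    entries of w_n at the other j_k for the quadratic form. The weights d/4 * 2^-k sum to at most
    d/2. *)
Definition hump d w (j : nat -> nat) :=
  [/\ forall i, d <= `|schreier_val (w i) (j i)|,
      {homo j : m n / (m < n)%N} &
      forall i k, (i < k)%N ->
        `|schreier_val (w i) (j k)| <= d / 4 * 2^-1 ^+ k /\
        `|schreier_val (w k) (j i)| <= d / 4 * 2^-1 ^+ k].

Lemma hump_coef_gt0 d k : 0 < d -> 0 < d / 4 * 2^-1 ^+ k.
Proof. by move=> d0; rewrite mulr_gt0 ?half_exp_gt0// divr_gt0. Qed.

Lemma hump_subseq d w j (phi : nat -> nat) :
  {homo phi : m n / (m < n)%N} -> 0 < d -> hump d w j ->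
  hump d (w \o phi) (j \o phi).
Proof.
move=> phiI d0 [wj jI wk]; split=> [i|m n /phiI/jI//|i k /phiI/wk[a b]] //=.
have le : d / 4 * 2^-1 ^+ phi k <= d / 4 * 2^-1 ^+ k.
  rewrite ler_wpM2l ?divr_ge0 ?(ltW d0)// ler_wiXn2l ?invr_ge0 ?invf_le1
    ?ler1n//.
  exact: homo_lt_ge phiI.
by split; [exact: le_trans a le|exact: le_trans b le].
Qed.

Lemma hump_sum_le d (a : nat -> F) n N : 0 < d ->
  (forall k, (k < n)%N -> a k <= d / 4 * 2^-1 ^+ n) ->
  (forall k, (n < k)%N -> a k <= d / 4 * 2^-1 ^+ k) ->
  \sum_(k < N | k != n :> nat) a k <= d / 2.
Proof.
move=> d0 lo hi.
have d4 : 0 <= d / 4 by rewrite divr_ge0// ltW.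
have -> : d / 2 = d / 4 * 2 by field.
apply: le_trans (ler_wpM2l d4 (geo_half_sum F N)).
rewrite mulr_sumr big_mkcond /=; apply: ler_sum => k _.
case: (ltngtP k n) => [kn|kn|_]; last by rewrite mulr_ge0// ltW ?half_exp_gt0.
  apply: le_trans (lo _ kn) _; rewrite ler_wpM2l//.
  by rewrite ler_wiXn2l ?invr_ge0 ?invf_le1 ?ler1n// ltnW.
exact: hi.
Qed.

Lemma coord_null_hump v : coord_null v -> ~ sup_null v ->
  exists2 d, 0 < d & exists psi : nat -> nat, {homo psi : m n / (m < n)%N} /\
    exists j, hump d (v \o psi) j.
Proof.
move=> v0 nv.
have [d [d0 nd]] : exists d : F, 0 < d /\
    ~ \forall n \near \oo, forall j, `|schreier_val (v n) j| <= d.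
  apply: contrapT => /forallNP nd; apply: nv => d d0; apply: contrapT => nn.
  exact: nd d (conj d0 nn).
exists d => //; have [psi [psiI psiP]] := not_near_subsequence nd.
have /choice[j jP] n : exists j, d <= `|schreier_val (v (psi n)) j|.
  have /existsNP[j nj] := psiP n; exists j.
  by apply/ltW/ltr_not_le; [exact: normr_ge0|exact: ltW|exact: nj].
have w0 := coord_null_subseq psiI v0.
(* On coordinates below m the terms are eventually at most d/2 < d, so the humps move past every
   m. *)
have jI m : \forall n \near \oo, (m <= j n)%N.
  have d2 : 0 < d / 2 by rewrite divr_gt0.
  apply: filterS (near_all_lt (fun i (_ : (i < m)%N) => w0 i _ d2)) => n wn.
  rewrite leqNgt; apply/negP => /wn /=; apply/negP.
  rewrite -real_ltNge ?normr_real ?gtr0_real// (lt_le_trans _ (jP n))//.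
  by rewrite ltr_pdivrMr// ltr_pMr// ltr1n.
pose w n := v (psi n).
have [n f|phi phiP] := @ex_seq_pairwise nat 0%N (fun _ _ => True)
    (fun n m k => [/\ (m < k)%N, (j m < j k)%N,
      `|schreier_val (w m) (j k)| <= d / 4 * 2^-1 ^+ n &
      `|schreier_val (w k) (j m)| <= d / 4 * 2^-1 ^+ n]).
  suff /filter_ex[k kP] : \forall k \near \oo, forall i, (i < n)%N ->
      [/\ (f i < k)%N, (j (f i) < j k)%N,
      `|schreier_val (w (f i)) (j k)| <= d / 4 * 2^-1 ^+ n &
      `|schreier_val (w k) (j (f i))| <= d / 4 * 2^-1 ^+ n] by exists k.
  apply: near_all_lt => i _.
  have [m mP] := schreier_coord_tail (w (f i)) (hump_coef_gt0 n d0).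
  have G1 := near_infty_gt (f i); have G2 := jI (j (f i)).+1; have G3 := jI m.
  have G4 := w0 (j (f i)) _ (hump_coef_gt0 n d0).
  near=> k; split; [by near: k|by near: k| |by near: k].
  by apply: mP; near: k.
exists (psi \o phi); split.
  by move=> m n mn; apply: psiI; have [_ /(_ _ mn)[]] := phiP n.
exists (j \o phi); split=> [i|m n mn|i k ik] /=; first exact: jP.
  by have [_ /(_ _ mn)[]] := phiP n.
by have [_ /(_ _ ik)[]] := phiP k.
Unshelve. all: by end_near. Qed.

(** Since j_i >= i >= N, the N coordinates j_N, ..., j_(2N-1) form an admissible set. At each of
    them the diagonal entry, at least d, loses at most d/2 to the others. *)
Lemma hump_block_norm d w j N : 0 < d -> hump d w j ->
  N%:R * (d / 2) <= `|\sum_(k < N + N) w k|.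
Proof.
move=> d0 [wj jI wk].
have ju : uniq [seq j i | i <- iota N N].
  rewrite map_inj_uniq ?iota_uniq// => m n jmn.
  by have [/jI|/jI|//] := ltngtP m n; rewrite jmn ltnn.
have [A AE] := exists_fset ju.
have aA : admissible A.
  move=> n nA; have /mapP[i + ->] : (n : nat) \in [seq j i | i <- iota N N].
    by rewrite -(perm_mem AE).
  rewrite mem_iota => /andP[Ni _].
  rewrite (perm_size AE) size_map size_iota.
  by apply: leq_trans Ni _; rewrite leqW// (homo_lt_ge _ jI).
apply: le_trans (schreier_norm_ge _ aA).
rewrite /admissible_sum (perm_big _ AE) big_map /=.
apply: (@le_trans _ _ (\sum_(i <- iota N N) d / 2)).
  by rewrite big_const_seq count_predT size_iota iter_addr_0 mulr_natl.
rewrite big_seq [leRHS]big_seq; apply: ler_sum => n;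
  rewrite mem_iota => /andP[_ nN].
rewrite schreier_val_sum (bigD1 (Ordinal nN))//=.
have tail : \sum_(k < N + N | k != n :> nat) `|schreier_val (w k) (j n)| <= d /
  2.
  apply: (@hump_sum_le d (fun k => `|schreier_val (w k) (j n)|)) => // k kn.
    by have [] := wk _ _ kn.
  by have [] := wk _ _ kn.
rewrite -(lerD2r (d / 2)) -splitr (le_trans (wj n))//.
set a := schreier_val (w n) (j n); set b := \sum_(i < N + N | _) _.
have := ler_normB (a + b) b; rewrite addrK => /le_trans; apply; rewrite lerD2l.
exact: le_trans (ler_norm_sum _ _ _) tail.
Qed.

Definition norm_bounded (A : set (schreier F)) :=
  exists2 C, 0 <= C & forall x, A x -> `|x| <= C.

Definition sup_rel_compact (A : set (schreier F)) :=
  forall u, (forall n, A (u n)) ->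
    exists phi : nat -> nat, {homo phi : m n / (m < n)%N} /\
      exists l, sup_converges (u \o phi) l.

(** A term is recovered from consecutive means as (n+2) s_(n+1) - (n+1) s_n. Bounded means thus
    allow only linear growth, while an unbounded set yields terms growing quadratically, even along
    subsequences. *)
Lemma banach_saks_norm_bounded A : banach_saks_set A -> norm_bounded A.
Proof.
move=> bsA; apply: contrapT => /forall2NP nb.
have /choice[u uP] n : exists x, A x /\ n.+1%:R * n.+1%:R <= `|x|.
  have n0 : 0 <= n.+1%:R * n.+1%:R :> F by rewrite mulr_ge0.
  have [//|/existsNP[x /not_implyP[Ax xn]]] := nb (n.+1%:R * n.+1%:R).
  by exists x; split=> //; apply/ltW/ltr_not_le.
have [phi [phiI /cvg_ex[/= l sl]]] := bsA u (fun n => proj1 (uP n)).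
pose s n := n.+1%:R^-1 *: \sum_(i < n.+1) u (phi i).
pose K := `|l| + 1.
have K0 : 0 <= K by rewrite addr_ge0.
have [N _ NP] : \forall n \near \oo, `|s n| <= K.
  move/cvgrPdist_le: sl => /(_ 1 ltr01); apply: filterS => n ln.
  rewrite -[s n](subrK l) addrC (le_trans (ler_normD _ _))// lerD2l.
  by rewrite distrC.
have sE n : n.+1%:R *: s n = \sum_(i < n.+1) u (phi i).
  by rewrite scalerA mulfV ?scale1r ?pnatr_eq0.
have K2 : 0 <= K + K by rewrite addr_ge0.
have [M _ MP] := near_le_natr_mul (addr_ge0 K2 ler01) (@ltr01 F).
pose n := maxn N M.
have uE : u (phi n.+1) = n.+2%:R *: s n.+1 - n.+1%:R *: s n.
  by rewrite !sE [in RHS]big_ord_recr /= addrAC subrr add0r.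
have : n.+2%:R * n.+2%:R <= n.+2%:R * (K + K).
  apply: (@le_trans _ _ `|u (phi n.+1)|).
    apply: le_trans (proj2 (uP _)).
    by rewrite ler_pM// ler_nat ltnS homo_lt_ge.
  have sK k m : (N <= m)%N -> `|k%:R *: s m| <= k%:R * K.
    by move=> Nm; rewrite [leLHS]normrZ ger0_norm// ler_wpM2l//; exact: NP.
  rewrite uE (le_trans (ler_normB _ _))// mulrDr lerD//.
    by apply: sK; rewrite leqW// leq_maxl.
  apply: le_trans (sK _ _ (leq_maxl _ _)) _.
  by rewrite ler_wpM2r// ler_nat.
rewrite ler_pM2l// => nK.
have : n.+2%:R <= n%:R - 1 :> F.
  rewrite lerBrDr; apply: le_trans (_ : K + K + 1 <= _);
    first by rewrite lerD2r.
  by have := MP n (leq_maxr _ _); rewrite mulr1.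
rewrite lerBrDr natr1 ler_nat; lia.
Qed.

Lemma banach_saks_sup_rel_compact A : banach_saks_set A -> sup_rel_compact A.
Proof.
move=> bsA u Au; have [C C0 AC] := banach_saks_norm_bounded bsA.
have [phi [phiI [y yP]]] := coord_convergent_subsequence (fun n => AC _ (Au n)).
exists phi; split=> //.
(* Whatever the subsequence, a norm limit of means has coordinates y. This places y in S and forces
   all such limits to coincide. *)
have mean_coord (th : nat -> nat) (l : schreier F) : {homo th : m n / (m <
  n)%N} ->
    n.+1%:R^-1 *: \sum_(i < n.+1) u (phi (th i)) @[n --> \oo] --> l ->
    forall j, schreier_val l j = y j.
  move=> thI sl j; apply/eqP; rewrite -subr_eq0 -normr_le0.
  apply/ler_addgt0Pr => e e0; rewrite add0r.
  have e2 : 0 < e / 2 by rewrite divr_gt0.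
  have bP d : 0 < d -> \forall n \near \oo,
      `|schreier_val (u (phi (th n))) j - y j| <= d.
    by move=> /(yP j); exact: homo_lt_cvg thI _.
  have N1 := cesaro_mean bP e2.
  move/cvgrPdist_le: sl => /(_ _ e2) N2.
  near \oo => n.
  have n1 : `|n.+1%:R^-1 * \sum_(i < n.+1) schreier_val (u (phi (th i))) j - y
    j|
      <= e / 2 by near: n.
  have n2 : `|l - n.+1%:R^-1 *: \sum_(i < n.+1) u (phi (th i))| <= e / 2 by
    near: n.
  set s := n.+1%:R^-1 * _ in n1.
  rewrite -(subrK s (schreier_val l j)) -addrA (le_trans (ler_normD _ _))//.
  rewrite [leRHS]splitr lerD//; apply: le_trans n2.
  have := schreier_coord_le (l - n.+1%:R^-1 *: \sum_(i < n.+1) u (phi (th i)))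
    j.
  rewrite -[schreier_val (_ - _) j]/(schreier_val l j - n.+1%:R^-1 *
    schreier_val (\sum_(i < n.+1) u (phi (th i))) j).
  by rewrite (schreier_val_sum _ (u \o phi \o th)).
have [th [thI /cvg_ex[/= l sl]]] := bsA (u \o phi) (fun n => Au (phi n)).
have lE := mean_coord th l thI sl.
exists l; apply: contrapT => nv.
have v0 : coord_null (fun n => (u \o phi) n - l).
  move=> j e e0; apply: filterS (yP j e e0) => n.
  by rewrite -[schreier_val (_ - _) j]/(schreier_val (u (phi n)) j -
    schreier_val l j) lE.
have [d d0 [psi [psiI [j hj]]]] := coord_null_hump v0 nv.
have [ch [chI /cvg_ex[/= l' sl']]] :=
  bsA (u \o phi \o psi) (fun n => Au (phi (psi n))).
have l'l : l' = l.
  apply/val_inj/funext => i /=; rewrite lE.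
  apply: (mean_coord (psi \o ch) l') => //.
  by move=> m n mn; exact/psiI/chI.
rewrite {}l'l in sl'.
(* The mean of 2(N+1) humps has norm at least (N+1)(d/2) / (2(N+1)) = d/4, which exceeds d/8. *)
have d4 : 0 < d / 8 by rewrite divr_gt0.
move/cvgrPdist_le: sl' => /(_ _ d4)[N _ NP].
have hc := hump_subseq chI d0 hj.
have := hump_block_norm N.+1 d0 hc.
pose s := (N.+1 + N)%N.
have -> : (N.+1 + N.+1)%N = s.+1 by rewrite addnS.
have sN : (N <= s)%N by rewrite /s; lia.
have := NP s sN; rewrite distrC.
have -> : s.+1%:R^-1 *: \sum_(i < s.+1) (u \o phi \o psi) (ch i) - l =
    s.+1%:R^-1 *: \sum_(i < s.+1) ((fun n => (u \o phi) n - l) \o psi \o ch) i.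
  rewrite big_split /= sumr_const card_ord scalerDr; congr (_ + _).
  by rewrite mulNrn scalerN -[l *+ _]scaler_nat scalerA mulVf ?pnatr_eq0//
    scale1r.
rewrite normrZ ger0_norm ?invr_ge0// mulrC ler_pdivrMr// => h1 h2.
have := le_trans h2 h1.
have -> : d / 8 * s.+1%:R = N.+1%:R * (d / 4).
  by rewrite /s -addnS natrD; field.
rewrite ler_pM2l// ler_pM2l// lef_pV2 ?posrE// ler_nat.
by [].
Unshelve. all: by end_near. Qed.
End BanachSaks.

(** * Diagonal quadratic polynomials *)

Section PCompact.
Variable F : scalar_field.
Implicit Types (u v w : nat -> schreier F) (e d : F).

(* The elements of B that are at least |B| / 2 contain an admissible set of
   cardinality at least |B| / 2. *)
Lemma exists_small_coord (x : schreier F) (B : {fset nat}) : B != fset0 ->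
  exists2 j, j \in B & `|schreier_val x j| * #|` B|%:R <= 2 * `|x|.
Proof.
move=> B0; apply: contrapT => nB; set n := #|` B|.
have n0 : (0 < n)%N by rewrite cardfs_gt0.
have {}nB j : j \in B -> 2 * `|x| < `|schreier_val x j| * n%:R.
  move=> jB; apply: ltr_not_le; rewrite ?mulr_ge0// => xj; apply: nB.
  by exists j.
(* Fewer than half of n distinct indices can lie below n./2, up to rounding. With indices from 0, an
   element j >= n./2 admits cardinality n./2 + 1, which covers n - n./2 for odd n as well. *)
pose s := take (n - n./2) [seq j <- B | (n./2 <= j)%N].
have hs : (n - n./2 <= size [seq j <- B | (n./2 <= j)%N])%N.
  have := count_predC (fun j => n./2 <= j)%N B; rewrite -size_filter.
  suff : (count (predC (fun j => n./2 <= j)%N) B <= n./2)%N by rewrite -/n; lia.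
  rewrite -size_filter -[leqRHS](size_iota 0); apply: uniq_leq_size.
    by rewrite filter_uniq// fset_uniq.
  by move=> j; rewrite mem_filter mem_iota /= -ltnNge => /andP[].
have ss : size s = (n - n./2)%N by rewrite size_takel.
have sB j : j \in s -> j \in B /\ (n./2 <= j)%N.
  by move=> /mem_take; rewrite mem_filter => /andP[].
have [A As] : exists A : {fset nat}, perm_eq A s.
  by apply: exists_fset; rewrite take_uniq// filter_uniq// fset_uniq.
have aA : admissible A.
  move=> j; rewrite (perm_mem As) => /sB[_ nj].
  by rewrite (perm_size As) ss; lia.
have : admissible_sum (schreier_val x) A <= `|x| := schreier_norm_ge x aA;
  apply/negP.
rewrite -real_ltNge ?normr_real ?ger0_real ?admissible_sum_ge0//.
rewrite /admissible_sum (perm_big _ As) -(ltr_pM2r (x := n%:R)) ?ltr0n//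
  mulr_suml.
apply: (@le_lt_trans _ _ (\sum_(j <- s) 2 * `|x|)).
  rewrite big_const_seq count_predT ss iter_addr_0 -[leRHS]mulr_natl mulrA.
  rewrite [leLHS]mulrC ler_wpM2r// -natrM ler_nat; lia.
rewrite big_seq [ltRHS]big_seq; apply: ltr_sum => [|j /sB[+ _]]; last exact: nB.
have s0 : (0 < size s)%N by rewrite ss; lia.
by apply/hasP; exists (nth 0%N s 0); exact: mem_nth.
Qed.

Lemma inv_square_sum n : \sum_(i < n) i.+1%:R ^- 2 <= 2 :> F.
Proof.
case: n => [|n]; first by rewrite big_ord0.
suff : \sum_(i < n.+1) i.+1%:R ^- 2 <= 2 - n.+1%:R^-1 :> F.
  by move=> /le_trans; apply; rewrite gerBl invr_ge0.
elim: n => [|n IH].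
  rewrite big_ord_recr big_ord0 /= add0r expr1n invr1.
  by rewrite (_ : 2 - 1 = 1 :> F)//; ring.
rewrite big_ord_recr /= -lerBrDr (le_trans IH)//.
rewrite -[leRHS]addrA lerD2l -opprD lerN2 -lerBrDl.
have n1 : 0 < n.+1%:R :> F by [].
have n2 : 0 < n.+2%:R :> F by [].
rewrite -(ler_pM2r (mulr_gt0 n1 (mulr_gt0 n2 n2))).
have -> : (n.+1%:R^-1 - n.+2%:R^-1) * (n.+1%:R * (n.+2%:R * n.+2%:R)) = n.+2%:R
  :> F.
  by field; rewrite -natrD nat1r !pnatr_eq0.
have -> : n.+2%:R ^- 2 * (n.+1%:R * (n.+2%:R * n.+2%:R)) = n.+1%:R :> F.
  by field; rewrite -natrD pnatr_eq0.
by rewrite ler_nat.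
Qed.

(* Removing a small coordinate at each step bounds the decreasing rearrangement
   of x by 2 |x| / n, so that x is in weak l1. *)
Lemma square_sum_le (x : schreier F) (B : {fset nat}) :
  \sum_(j <- B) `|schreier_val x j| ^+ 2 <= 8 * `|x| ^+ 2.
Proof.
have H n : #|` B| = n -> \sum_(j <- B) `|schreier_val x j| ^+ 2 <=
    (2 * `|x|) ^+ 2 * \sum_(i < n) i.+1%:R ^- 2.
  elim: n B => [|n IH] B Bn.
    by move/cardfs0_eq: Bn => ->; rewrite big_seq_fset0 big_ord0 mulr0.
  have [|j jB xj] := @exists_small_coord x B.
    by rewrite -cardfs_gt0 Bn.
  rewrite (big_fsetD1 j)//= big_ord_recr /= mulrDr addrC lerD//.
    by apply: IH; have := cardfsD1 j B; rewrite jB Bn; lia.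
  rewrite -exprVn -exprMn lerXn2r ?nnegrE ?mulr_ge0 ?invr_ge0//.
  by rewrite -Bn ler_pdivlMr// ltr0n Bn.
apply: le_trans (H _ erefl) _.
apply: le_trans (ler_wpM2l _ (inv_square_sum _)) _;
  first exact: exprn_ge0 (mulr_ge0 _ _).
by rewrite exprMn le_eqVlt; apply/orP; left; apply/eqP; ring.
Qed.

(** Cauchy-Schwarz without square roots, from (|y| a - |x| b)^2 >= 0 summed over coordinates. The
    factor 2 |x| |y| is then cancelled, so x = 0 and y = 0 are treated apart. *)
Lemma product_sum_le (x y : schreier F) (s : seq nat) : uniq s ->
  \sum_(j <- s) `|schreier_val x j| * `|schreier_val y j| <= 8 * `|x| * `|y|.
Proof.
move=> us; have [B Bs] := exists_fset us.
rewrite -(perm_big _ Bs) /=.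
have [->|x0] := eqVneq x 0.
  by rewrite big1 ?normr0 ?mulr0 ?mul0r// => j _; rewrite normr0 mul0r.
have [->|y0] := eqVneq y 0.
  by rewrite big1 ?normr0 ?mulr0// => j _; rewrite normr0 mulr0.
have x1 : 0 < `|x| by rewrite normr_gt0.
have y1 : 0 < `|y| by rewrite normr_gt0.
rewrite -(ler_pM2l (mulr_gt0 (ltr0n F 2) (mulr_gt0 x1 y1))).
apply: (@le_trans _ _ (`|y| ^+ 2 * (\sum_(j <- B) `|schreier_val x j| ^+ 2)
    + `|x| ^+ 2 * (\sum_(j <- B) `|schreier_val y j| ^+ 2))).
  rewrite !mulr_sumr -big_split; apply: ler_sum => j _ /=.
  set a := `|schreier_val x j|; set b := `|schreier_val y j|.
  rewrite -subr_ge0.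
  have -> : `|y| ^+ 2 * a ^+ 2 + `|x| ^+ 2 * b ^+ 2 - 2 * (`|x| * `|y|) * (a *
    b) =
      (`|y| * a - `|x| * b) ^+ 2 by ring.
  by rewrite real_exprn_even_ge0// rpredB// rpredM// normr_real.
apply: (@le_trans _ _ (`|y| ^+ 2 * (8 * `|x| ^+ 2) + `|x| ^+ 2 * (8 * `|y| ^+
  2))).
  by rewrite lerD// ler_wpM2l ?exprn_ge0// square_sum_le.
by rewrite le_eqVlt; apply/orP; left; apply/eqP; ring.
Qed.

Lemma sparse_bilinear_form (t : nat -> F) (j : nat -> nat) :
  (forall i, `|t i| <= 1) -> {homo j : m n / (m < n)%N} ->
  exists b : schreier F -> schreier F -> F,
    [/\ forall y, scalar (b^~ y), forall x, scalar (b x),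
        forall x y, `|b x y| <= 8 * `|x| * `|y| &
        forall x y, (fun N => \sum_(i < N)
          t i * (schreier_val x (j i) * schreier_val y (j i))) @ \oo --> b x y].
Proof.
move=> t1 jI.
pose g x i (y : schreier F) := t i * (schreier_val x (j i) * schreier_val y (j
  i)).
have gS x y N : \sum_(i < N) `|g x i y| <= 8 * `|x| * `|y|.
  have us : uniq [seq j i | i <- iota 0 N].
    rewrite map_inj_uniq ?iota_uniq// => m n jmn.
    by have [/jI|/jI|//] := ltngtP m n; rewrite jmn ltnn.
  apply: le_trans (product_sum_le x y us).
  rewrite big_map -[in leRHS](subn0 N) -/(index_iota 0 N) big_mkord.
  by apply: ler_sum => i _; rewrite !normrM ler_piMl ?mulr_ge0.
have gs x i : scalar (g x i).
  move=> a y z; rewrite /g.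
  rewrite -[schreier_val (_ + _) _]/(a * schreier_val y (j i) + schreier_val z
    (j i)).
  by rewrite /=; ring.
have gC x y i : g x i y = g y i x by rewrite /g [schreier_val x _ * _]mulrC.
have /choice[b bP] x : exists f : schreier F -> F, scalar f /\
    forall y, (fun N => \sum_(i < N) g x i y) @ \oo --> f y.
  have [|f sf fg] := series_functional (gs x); last by exists f.
  by move=> y; exists (8 * `|x| * `|y|) => N; exact: gS.
exists b; split=> [y|x|x y|x y].
(* The series defines b x as a functional of the second variable only; symmetry and uniqueness of
   limits transfer linearity to the first. *)
- have bC x : b x y = b y x.
    have := (bP x).2 y; have -> : (fun N => \sum_(i < N) g x i y) =
        (fun N => \sum_(i < N) g y i x).
      by apply/funext => N; apply: eq_bigr => i _.
    by move=> h1; exact: (cvg_unique (@norm_hausdorff _ F) h1 ((bP y).2 x)).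
  by move=> a x z; rewrite !bC ((bP y).1 a x z).
- exact: (bP x).1.
- rewrite -[b x y]subr0; apply: limit_norm_le ((bP x).2 y) _.
  apply: nearW => N; rewrite subr0.
  by apply: le_trans (ler_norm_sum _ _ _) (gS x y N).
- exact: (bP x).2.
Qed.

Lemma bilinear_form_polynomial (b : schreier F -> schreier F -> F) (K : F) :
  (forall y, scalar (b^~ y)) -> (forall x, scalar (b x)) -> 0 <= K ->
  (forall x y, `|b x y| <= K * `|x| * `|y|) ->
  continuous_homogeneous_polynomial 2 (fun x => b x x).
Proof.
move=> b1 b2 K0 bK.
pose i0 : 'I_2 := ord0; pose i1 : 'I_2 := ord_max.
exists (fun x => b (x i0) (x i1)); split=> //.
  move=> x i a u v /=.
  have [->|ii0] := eqVneq i i0.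
    rewrite !dfwithin !dfwithout//; exact: (b1 _ a u v).
  have -> : i = i1 by apply/val_inj; case: i ii0 => -[|[|]].
  by rewrite !dfwithin !dfwithout//; exact: b2.
move=> x0; apply: (@cvgrPdist_le F F _ (nbhs (x0 : {ptws 'I_2 -> schreier F})) _
  (fun x => b (x i0) (x i1)) (b (x0 i0) (x0 i1))).2 => e e0.
pose L := K * (`|x0 i0| + `|x0 i1| + 1).
have L0 : 0 <= L by rewrite mulr_ge0// !addr_ge0.
have eL : 0 < e + L by rewrite ltr_wpDr.
(* This choice gives both d <= 1 and L d <= e without taking a minimum. *)
pose d := e / (e + L).
have d0 : 0 < d by rewrite divr_gt0.
have d1 : d <= 1 by rewrite ler_pdivrMr// mul1r lerDl.
have Ld : L * d <= e.
  by rewrite mulrCA ger_pMr// ler_pdivrMr// mul1r lerDr ltW.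
have C (i : 'I_2) : \forall x \near (x0 : {ptws 'I_2 -> schreier F}), `|x0 i -
  x i| <= d.
  exact: (@proj_continuous _ (fun=> schreier F) i x0 _ (near_dist_le (x0 i)
    d0)).
have C0 := C i0; have C1 := C i1.
near=> x.
have h0 : `|x0 i0 - x i0| <= d by near: x.
have h1 : `|x0 i1 - x i1| <= d by near: x.
have -> : b (x0 i0) (x0 i1) - b (x i0) (x i1) =
    b (x0 i0 - x i0) (x i1) + b (x0 i0) (x0 i1 - x i1).
  have -> z : b (x0 i0 - x i0) z = b (x0 i0) z - b (x i0) z.
    by rewrite -scaleN1r addrC (b1 z) mulN1r addrC.
  have -> z : b z (x0 i1 - x i1) = b z (x0 i1) - b z (x i1).
    by rewrite -scaleN1r addrC (b2 z) mulN1r addrC.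
  by ring.
apply: le_trans Ld; apply: le_trans (ler_normD _ _) _.
have -> : L * d = K * d * (`|x0 i1| + 1) + K * `|x0 i0| * d by rewrite /L; ring.
apply: lerD; apply: le_trans (bK _ _) _; last by rewrite ler_wpM2l ?mulr_ge0.
apply: ler_pM; rewrite ?mulr_ge0//; first by rewrite ler_wpM2l.
rewrite -[x i1](subrK (x0 i1)) addrC (le_trans (ler_normD _ _))// lerD2l.
by rewrite distrC (le_trans h1).
Unshelve. all: by end_near. Qed.

Lemma functional_polynomial (f : schreier F -> F) : scalar f -> continuous f ->
  continuous_homogeneous_polynomial 1 f.
Proof.
move=> sf cf; exists (fun x => f (x ord0)); split=> //.
  by move=> x i a u v; rewrite (ord1 i) /= !dfwithin; exact: sf.
move=> x; apply: (@continuous_comp _ _ _ (fun y : {ptws 'I_1 -> schreier F} =>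
  y ord0) f).
  exact: (@proj_continuous _ (fun=> schreier F) ord0).
exact: cf.
Qed.

Lemma coord_functional (i : nat) :
  scalar (fun x : schreier F => schreier_val x i) /\
  bounded_functional (fun x : schreier F => schreier_val x i).
Proof.
split=> [a x y //|]; exists 1 => // x; rewrite mul1r.
exact: schreier_coord_le.
Qed.

Lemma P_compact_norm_bounded (A : set (schreier F)) :
  relatively_P_compact A -> norm_bounded A.
Proof.
move=> PA; apply: pointwise_bounded_norm_bounded => f sf cf.
apply: contrapT => /forallNP nb.
have /choice[u uP] n : exists x, A x /\ n%:R <= `|f x|.
  have /existsNP[x /not_implyP[Ax xn]] := nb n%:R.
  by exists x; split=> //; apply/ltW/ltr_not_le.
have [phi [phiI [l ul]]] := PA u (fun n => proj1 (uP n)).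
have := ul 1%N f isT (functional_polynomial sf cf).
move/cvgrPdist_le => /(_ 1 ltr01).
exact: (@subsequence_not_unbounded F (f \o u) _ _ phiI (fun n => (uP n).2)).
Qed.

(* Along a hump the polynomial x |-> sum_i t_i x(j_i)^2, with phases t_i that
   make t_i w_i(j_i)^2 nonnegative, does not tend to 0. *)
Lemma P_compact_sup_rel_compact (A : set (schreier F)) :
  relatively_P_compact A -> sup_rel_compact A.
Proof.
move=> PA u Au; have [C0 C00 AC] := P_compact_norm_bounded PA.
have [phi [phiI [l ul]]] := PA u Au.
exists phi; split=> //; exists l; apply: contrapT => nv.
pose v n := u (phi n) - l.
have weak (f : schreier F -> F) : scalar f -> bounded_functional f ->
    forall e, 0 < e -> \forall n \near \oo, `|f (v n)| <= e.
  move=> sf bf e e0; have cf := bounded_functional_continuous sf bf.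
  have := ul 1%N f isT (functional_polynomial sf cf).
  move/cvgrPdist_le => /(_ e e0); apply: filterS => n.
  by rewrite /v (scalarD sf) -[- l]scaleN1r (scalarZ sf) mulN1r distrC.
have v0 : coord_null v.
  by move=> i e e0; have [sc bc] := coord_functional i;
    exact: (weak _ sc bc e e0).
have [d d0 [psi [psiI [j [wj jI wk]]]]] := coord_null_hump v0 nv.
pose w := v \o psi.
pose a i := schreier_val (w i) (j i).
have /choice[t tP] i : exists t : F, `|t| <= 1 /\ t * (a i * a i) = `|a i| ^+ 2.
  have [t t1 ta] := unit_phase (a i * a i).
  by exists t; split=> //; rewrite ta normrM.
have [b [b1 b2 bK bS]] := sparse_bilinear_form (fun i => proj1 (tP i)) jI.
have K0 : 0 <= 8 :> F by [].
have bP := bilinear_form_polynomial b1 b2 K0 bK.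
(* Three errors of d^2 / 8 and an off-diagonal part of d^2 / 2 total 7/8 d^2, below the diagonal
   term d^2. *)
have d2 : 0 < d ^+ 2 / 8 by rewrite divr_gt0// exprn_gt0.
have := ul 2%N _ isT bP; move/cvgrPdist_le => /(_ _ d2).
move=> /(homo_lt_cvg psiI) B1.
(* The cross terms b(l, w) and b(w, l) in the expansion of b(l + w, l + w) are bounded functionals
   of w, hence null by the degree 1 case. *)
have bl2 : bounded_functional (b l).
  exists (8 * `|l|) => [|x]; first by rewrite mulr_ge0.
  exact: bK.
have bl1 : bounded_functional (b^~ l).
  exists (8 * `|l|) => [|x]; first by rewrite mulr_ge0.
  by rewrite mulrAC.
have B2 := homo_lt_cvg psiI (weak _ (b2 l) bl2 _ d2).
have B3 := homo_lt_cvg psiI (weak _ (b1 l) bl1 _ d2).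
have /filter_ex[n [n1 n2 n3]] : \forall n \near \oo,
   [/\ `|b l l - b (u (phi (psi n))) (u (phi (psi n)))| <= d ^+ 2 / 8,
       `|b l (w n)| <= d ^+ 2 / 8 & `|b (w n) l| <= d ^+ 2 / 8].
  by near=> n; split; near: n.
have bw : `|b (w n) (w n)| <= d ^+ 2 / 8 + d ^+ 2 / 8 + d ^+ 2 / 8.
  have E : u (phi (psi n)) = l + w n by rewrite /w /= /v addrC subrK.
  have -> : b (w n) (w n) = b (l + w n) (l + w n) - b l l - b l (w n) - b (w n)
    l.
    have -> z : b (l + w n) z = b l z + b (w n) z by rewrite (scalarD (b1 z)).
    by rewrite !(scalarD (b2 _)); ring.
  rewrite -E; apply: le_trans (ler_normB _ _) _; rewrite lerD//.
  by apply: le_trans (ler_normB _ _) _; rewrite lerD// distrC.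
have big : d ^+ 2 <= `|a n| ^+ 2.
  by rewrite lerXn2r ?nnegrE ?(ltW d0)//; exact: wj.
have near_big : `|b (w n) (w n) - `|a n| ^+ 2| <= d / 2 * d.
  apply: limit_norm_le (bS (w n) (w n)) _.
  exists n.+1 => // N /= nN.
  rewrite (bigD1 (Ordinal nN))//= (tP n).2 addrAC subrr add0r.
  apply: le_trans (ler_norm_sum _ _ _) _.
  pose h i := `|schreier_val (w n) (j i)|.
  apply: (@le_trans _ _ (\sum_(i < N | i != n :> nat) h i * d)).
    apply: ler_sum => i ni; rewrite normrM.
    apply: le_trans (ler_piMl (normr_ge0 _) (tP i).1) _; rewrite normrM.
    rewrite ler_wpM2l//.
    have dk k : d / 4 * 2^-1 ^+ k <= d.
      rewrite -mulrA ger_pMr// mulr_ile1 ?invr_ge0 ?exprn_ge0 ?invf_le1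
        ?ler1n//.
      by rewrite exprn_ile1 ?invr_ge0 ?invf_le1 ?ler1n.
    have [lt|lt|eq] := ltngtP i n; last by move: ni;
      rewrite -val_eqE /= eq eqxx.
      by have [_ le] := wk _ _ lt; exact: le_trans le (dk _).
    by have [le _] := wk _ _ lt; exact: le_trans le (dk _).
  rewrite -mulr_suml ler_wpM2r ?(ltW d0)//.
  apply: (@hump_sum_le _ d h n N d0) => k lt.
    by have [] := wk _ _ lt.
  by have [] := wk _ _ lt.
have : d ^+ 2 <= d ^+ 2 / 8 + d ^+ 2 / 8 + d ^+ 2 / 8 + d / 2 * d.
  apply: le_trans big _.
  have -> : `|a n| ^+ 2 = `| b (w n) (w n) - (b (w n) (w n) - `|a n| ^+ 2)|.
    by rewrite opprB addrC subrK [RHS]ger0_norm // exprn_ge0.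
  by apply: le_trans (ler_normB _ _) _; rewrite lerD.
have -> : d ^+ 2 / 8 + d ^+ 2 / 8 + d ^+ 2 / 8 + d / 2 * d = d ^+ 2 * (7 / 8).
  by field.
by rewrite ler_pMr ?exprn_gt0// ler_pdivlMr// mul1r ler_nat.
Unshelve. all: by end_near. Qed.

End PCompact.

(** * Compactness in the sup norm and in the weak topology *)

Section Compactness.
Variable F : scalar_field.

(** An ultrafilter on W contains a ball of each radius; otherwise some e would give an e-separated
    sequence in W. Points of W common to the first k balls of radii 1/(i+1) subconverge, and the
    ultrafilter converges to their limit. *)
Lemma sequentially_compact_compact (V : normedModType F) (W : set V) :
  (forall u : nat -> V, (forall n, W (u n)) ->
    exists phi : nat -> nat, {homo phi : m n / (m < n)%N} /\
      exists2 l, W l & forall e : F, 0 < e -> \forall n \near \oo, `|l - u (phi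
        n)| <= e) ->
  compact W.
Proof.
move=> Wseq; rewrite compact_ultra => G GU GW.
have small (e : F) : 0 < e -> exists x, G [set y | `|x - y| <= e].
  move=> e0; apply: contrapT => /forallNP nG.
  have [n f|u uP] := @ex_seq_pairwise V 0 (fun _ => W) (fun _ x y => ~ `|x - y|
    <= e).
    have H : G [set y | forall i, (i < n)%N -> ~ `|f i - y| <= e].
      apply: near_all_lt => i _.
      by have [/nG|] := in_ultra_setVsetC [set y | `|f i - y| <= e] GU.
    by have [x [Wx xf]] := filter_ex (filterI GW H); exists x.
  have [phi [phiI [l Wl ul]]] := Wseq u (fun n => (uP n).1).
  have e2 : 0 < e / 2 by rewrite divr_gt0.
  have [N _ NP] := ul _ e2.
  have [_ /(_ (phi N) (phiI _ _ (ltnSn N)))] := uP (phi N.+1); apply.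
  rewrite -(subrK l (u (phi N))) -addrA [e]splitr (le_trans (ler_normD _ _))//.
  by rewrite lerD// ?(distrC (u _)); apply: NP => /=.
have i0 k : 0 < k.+1%:R^-1 :> F by rewrite invr_gt0.
have /choice[x xP] k := small _ (i0 k).
have /choice[y yP] k : exists y, W y /\ forall i, (i < k.+1)%N -> `|x i - y| <=
  i.+1%:R^-1.
  have H : G [set y | forall i, (i < k.+1)%N -> `|x i - y| <= i.+1%:R^-1].
    by apply: near_all_lt => i _; exact: xP.
  by have [z [Wz zx]] := filter_ex (filterI GW H); exists z.
have [phi [phiI [l Wl yl]]] := Wseq y (fun k => (yP k).1).
exists l; split=> //; apply/cvgrPdist_le => e e0.
have e4 : 0 < e / 4 by rewrite divr_gt0.
have e2 : 0 < e / 2 by rewrite divr_gt0.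
have [k ke] : exists k, k.+1%:R^-1 <= e / 4.
  by have /filter_ex[k] := inv_succ_le e4; exists k.
have [N _ NP] := yl _ e2.
pose n := maxn N k.
have kphi : (k < (phi n).+1)%N.
  by rewrite ltnS (leq_trans _ (homo_lt_ge n phiI))// leq_maxr.
have ly : `|l - y (phi n)| <= e / 2 by apply: NP; rewrite /= leq_maxl.
have xy := (yP (phi n)).2 k kphi.
apply: filterS (xP k) => z xz.
have -> : l - z = (l - y (phi n)) + ((y (phi n) - x k) + (x k - z)).
  by rewrite addrA subrKA addrA subrK.
have -> : e = e / 2 + (e / 4 + e / 4) by field.
rewrite (le_trans (ler_normD _ _))// lerD// (le_trans (ler_normD _ _))// lerD//.
  by rewrite distrC (le_trans xy).
exact: le_trans xz ke.
Qed.

Lemma weak_functional_continuous (f : schreier F -> F) :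
  scalar f -> continuous f ->
  continuous (f : initial_topology (@dual_pairing F (schreier F)) -> F).
Proof.
move=> sf cf x.
pose f' : topological_dual (schreier F) := exist _ f (conj sf cf).
apply: (@continuous_comp _ _ _ (@dual_pairing F (schreier F) : initial_topology
  _ -> _)
  (fun h => h f')).
  exact: initial_continuous.
exact: ptws_eval_continuous.
Qed.

Lemma weak_hausdorff :
  hausdorff_space (initial_topology (@dual_pairing F (schreier F))).
Proof.
move=> x y xy; apply/val_inj/funext => i.
have [sf bf] := coord_functional F i.
have cf := weak_functional_continuous sf (bounded_functional_continuous sf bf).
apply: (@norm_hausdorff _ F) => A B /cf xA /cf yB.
by have [z [zA zB]] := xy _ _ xA yB; exists (schreier_val z i).
Qed.

(** Continuity of f for the sup norm on balls: counterexamples at scales 1/(n+1) would form a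
    bounded coordinatewise null sequence that is not weakly null. *)
Lemma functional_sup_small (f : schreier F -> F) (C e : F) :
  scalar f -> continuous f -> 0 < e ->
  exists2 d : F, 0 < d & forall x : schreier F, `|x| <= C ->
    (forall j, `|schreier_val x j| <= d) -> `|f x| <= e.
Proof.
move=> sf cf e0; apply: contrapT => /forall2NP nd.
have /choice[u uP] n : exists x : schreier F, [/\ `|x| <= C,
    forall j, `|schreier_val x j| <= n.+1%:R^-1 & ~ `|f x| <= e].
  have [|/existsNP[x /not_implyP[xC /not_implyP[xn xe]]]] := nd n.+1%:R^-1.
    by rewrite invr_gt0 ltr0n.
  by exists x.
have u0 : coord_null u.
  move=> j d /inv_succ_le; apply: filterS => n.
  by apply: le_trans; have [] := uP n.
have uC n : `|u n| <= C by have [] := uP n.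
have /filter_ex[n] := coord_null_weakly_null sf (dual_bounded sf cf) uC u0 e0.
by have [] := uP n.
Qed.
End Compactness.

Section Equivalences.
Variables (F : scalar_field) (A : set (schreier F)).

Lemma schreier_linf_inj : injective (@schreier_linf F).
Proof. by move=> x y /(congr1 (@linf_val F)) xy; apply: val_inj. Qed.

Lemma sup_rel_compact_weakly_compact : norm_bounded A -> sup_rel_compact A ->
  relatively_weakly_compact A /\ precompact (@schreier_linf F @` A).
Proof.
move=> [C C0 AC] Aseq.
(* B is the closure of A for the sup norm within the ball of radius C; the bound on B lets
   functionals be controlled by the sup norm. *)
pose B := [set l : schreier F | `|l| <= C /\ forall e, 0 < e ->
  exists2 a, A a & forall j, `|schreier_val (a - l) j| <= e].
pose W := @schreier_linf F @` B.
have AB : A `<=` B.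
  move=> a Aa; split; first exact: AC.
  move=> e e0; exists a => // j; rewrite subrr.
  by rewrite normr0 ltW.
have cW : compact W.
  apply: sequentially_compact_compact => z Wz.
  have /choice[l lP] n : exists l, B l /\ schreier_linf l = z n.
    by have [l Bl lz] := Wz n; exists l.
  have /choice[a aP] n : exists a, A a /\
      forall j, `|schreier_val (a - l n) j| <= n.+1%:R^-1.
    have [[_ /(_ n.+1%:R^-1)]] := lP n.
    by rewrite invr_gt0 ltr0n => /(_ isT)[a Aa al] _; exists a.
  have [phi [phiI [x ax]]] := Aseq a (fun n => (aP n).1).
  (* The Schreier norm does not increase under sup-norm limits, because each admissible sum involves
     finitely many coordinates. *)
  have xC : `|x| <= C.
    apply: schreier_norm_le => D aD.
    apply/ler_addgt0Pr => e e0.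
    have D1 : 0 < (#|` D|.+1)%:R :> F by [].
    have /filter_ex[n nx] := ax _ (divr_gt0 e0 D1).
    rewrite -[schreier_val x](subrK (schreier_val (a (phi n)))).
    apply: le_trans (admissible_sumD _ _ _) _; rewrite addrC lerD//.
      exact: le_trans (schreier_norm_ge _ aD) (AC _ (aP _).1).
    apply: (@le_trans _ _ (\sum_(j <- D) e / (#|` D|.+1)%:R)).
      by apply: ler_sum => j _; rewrite distrC; exact: nx.
    rewrite big_const_seq count_predT iter_addr_0 -[leLHS]mulr_natr mulrAC.
    by rewrite ler_pdivrMr// ler_wpM2l ?(ltW e0)// ler_nat.
  have Bx : B x.
    split=> // e e0; have /filter_ex[n nx] := ax _ e0.
    by exists (a (phi n)) => //; exact: (aP _).1.
  exists phi; split=> //; exists (schreier_linf x); first by exists x.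
  move=> e e0; have e2 : 0 < e / 2 by rewrite divr_gt0.
  have N1 := ax _ e2; have N2 := homo_lt_cvg phiI (inv_succ_le e2).
  near=> n; apply: linf_norm_le => j; rewrite -(lP (phi n)).2.
  have n1 : forall j, `|schreier_val ((a \o phi) n - x) j| <= e / 2 by near: n.
  have n2 : (phi n).+1%:R^-1 <= e / 2 by near: n.
  rewrite -[linf_val _ j]/(schreier_val x j - schreier_val (l (phi n)) j).
  rewrite -(subrK (schreier_val (a (phi n)) j) (schreier_val x j)) -addrA.
  apply: le_trans (ler_normD _ _) _; rewrite [leRHS]splitr lerD//.
    by rewrite distrC; exact: n1.
  exact: le_trans ((aP (phi n)).2 j) n2.
split; last first.
  apply: precompact_subset (compact_precompact (@norm_hausdorff _ _) cW).
  exact: image_subset.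
(* Inverse of the inclusion of S in l_infty, with default 0 off its range. Its continuity from W to
   the weak topology carries compactness over. *)
pose g (z : linf F) : initial_topology (@dual_pairing F (schreier F)) :=
  xget (0 : schreier F) [set l | schreier_linf l = z].
have gK x : g (schreier_linf x) = x.
  apply: schreier_linf_inj.
  by apply: (@xgetPex _ _ [set l | schreier_linf l = schreier_linf x]);
    exists x.
have gc : {within W, continuous g}.
  apply/subspace_continuousP => _ [x Bx <-].
  apply: initial_cvg; apply: ptws_cvg => -[f [sf cf]].
  apply/cvgrPdist_le => e e0.
  have [d d0 fd] := functional_sup_small (C + C) sf cf e0.
  apply: filterS (near_dist_le (schreier_linf x) d0) => z xz [y By yz].
  rewrite -yz /= /from_subspace !gK /dual_pairing /=.
  have -> : f x - f y = f (x - y).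
    by rewrite (scalarD sf) -[- y]scaleN1r (scalarZ sf) mulN1r.
  apply: fd => [|j].
    by apply: le_trans (ler_normB _ _) _; rewrite lerD ?Bx.1 ?By.1.
  by apply: le_trans xz; rewrite -yz; exact: (linf_norm_ge (schreier_linf x -
    schreier_linf y)).
apply: precompact_subset (compact_precompact (@weak_hausdorff F)
  (continuous_compact gc cW)).
by move=> x Ax; exists (schreier_linf x); [exists x => //; exact: AB|exact: gK].
Unshelve. all: by end_near. Qed.

Lemma weakly_compact_norm_bounded : relatively_weakly_compact A -> norm_bounded
  A.
Proof.
move=> [U AU [cU _]]; apply: pointwise_bounded_norm_bounded => f sf cf.
apply: contrapT => /forallNP nb.
have /choice[u uP] n : exists x, A x /\ n%:R <= `|f x|.
  have /existsNP[x /not_implyP[Ax xn]] := nb n%:R.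
  by exists x; split=> //; apply/ltW/ltr_not_le.
have [|x [_ ux]] := cU (u @ \oo) _.
  by exists 0%N => // n _; apply: AU; exact: (uP n).1.
have [n|phi [phiI phiP]] := @cluster_subsequence
    (initial_topology (@dual_pairing F (schreier F))) u x
    (fun _ z => `|f x - f z| <= 1) ux.
  exact: (weak_functional_continuous sf cf (near_dist_le (f x) ltr01)).
apply: (@subsequence_not_unbounded F (f \o u) _ (f x) phiI (fun n => (uP n).2)).
by apply: nearW => n; exact: phiP.
Qed.

(** Sup-norm compactness yields a limit in l_infty, possibly outside S. A weak cluster point of the
    same subsequence has the same coordinates, which puts that limit in S. *)
Lemma weakly_compact_sup_rel_compact : relatively_weakly_compact A ->
  precompact (@schreier_linf F @` A) -> sup_rel_compact A.
Proof.
move=> [U AU [cU _]] [W AW [cW _]] u Au.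
have [|y [_ uy]] := cW ((fun n => schreier_linf (u n)) @ \oo) _.
  by exists 0%N => // n _; apply: AW; exists (u n).
have [n|phi [phiI phiP]] := @cluster_subsequence (linf F) _ y
    (fun n z => `|y - z| <= n.+1%:R^-1) uy.
  by apply: near_dist_le; rewrite invr_gt0 ltr0n.
exists phi; split=> //.
have [|x [_ ux]] := cU ((u \o phi) @ \oo) _.
  by exists 0%N => // n _; apply: AU; exact: Au.
have yP n j : `|linf_val y j - schreier_val (u (phi n)) j| <= n.+1%:R^-1.
  apply: le_trans (phiP n).
  exact: (linf_norm_ge (y - schreier_linf (u (phi n))) j).
have xy j : linf_val y j = schreier_val x j.
  apply/eqP; rewrite -subr_eq0 -normr_le0; apply/ler_addgt0Pr => e e0.
  rewrite add0r; have e2 : 0 < e / 2 by rewrite divr_gt0.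
  have [sf bf] := coord_functional F j.
  have cf := weak_functional_continuous sf (bounded_functional_continuous sf
    bf).
  have [n|psi [psiI psiP]] := @cluster_subsequence
    (initial_topology (@dual_pairing F (schreier F))) (u \o phi) x
    (fun _ z => `|schreier_val x j - schreier_val z j| <= e / 2) ux.
    exact: (cf _ _ (near_dist_le (schreier_val x j) e2)).
  have /filter_ex[n ne] : \forall n \near \oo, (psi n).+1%:R^-1 <= e / 2.
    exact: homo_lt_cvg psiI _ (inv_succ_le e2).
  rewrite -(subrK (schreier_val (u (phi (psi n))) j) (linf_val y j)) -addrA.
  apply: le_trans (ler_normD _ _) _; rewrite [leRHS]splitr lerD//.
    exact: le_trans (yP _ _) ne.
  by rewrite distrC; exact: psiP.
exists x => e /inv_succ_le; apply: filterS => n ne j.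
by have := yP n j; rewrite xy distrC => /le_trans; apply.
Qed.

(** Domination by the basis of c0, with all coefficients 1, bounds the sums of the differences from
    l, so the means approach l at rate 1/n. *)
Lemma sup_rel_compact_banach_saks : norm_bounded A -> sup_rel_compact A ->
  banach_saks_set A.
Proof.
move=> [C C0 AC] Aseq u Au.
have [phi [phiI [l ul]]] := Aseq u Au.
pose v n := u (phi n) - l.
have vC n : `|v n| <= C + `|l|.
  by rewrite (le_trans (ler_normB _ _))// lerD2r AC.
have D0 : 0 <= C + `|l| by rewrite addr_ge0.
have [psi [psiI psiP]] := sup_null_c0_subsequence D0 vC ul.
exists (phi \o psi); split; first by move=> m n mn; exact/phiI/psiI.
apply/cvg_ex; exists l; apply/cvgrPdist_le => e e0.
have D2 : 0 <= C + `|l| + 2 by rewrite addr_ge0.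
apply: filterS (near_le_natr_mul D2 e0) => n ne.
have -> : l - n.+1%:R^-1 *: \sum_(i < n.+1) u ((phi \o psi) i) =
    - (n.+1%:R^-1 *: \sum_(i < n.+1) 1 *: v (psi i)).
  rewrite [X in _ = - (_ *: X)](eq_bigr (fun i : 'I_n.+1 => u (phi (psi i)) -
    l)) => [|i _]; last first.
    by rewrite scale1r.
  rewrite big_split /= sumr_const card_ord scalerDr opprD addrC; congr (_ + _).
  by rewrite mulNrn scalerN opprK -[l *+ _]scaler_nat scalerA mulVf
    ?pnatr_eq0// scale1r.
rewrite normrN normrZ ger0_norm ?invr_ge0// mulrC ler_pdivrMr//.
apply: le_trans (psiP n.+1 (fun=> 1) _) _; first by move=> _; rewrite normr1.
apply: le_trans ne _; rewrite mulrC ler_wpM2l ?(ltW e0)// ler_nat.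
exact: leqnSn.
Qed.

End Equivalences.

(** * Real and complex scalars *)

Section ScalarBalls.
Variable R : realType.

Lemma real_ball_precompact (B : real_scalars R) :
  precompact [set a : real_scalars R | `|a| <= B].
Proof.
apply: precompact_subset
  (compact_precompact (@norm_hausdorff R R) (@segment_compact R (- B) B)).
by move=> a /=; rewrite in_itv /= ler_norml.
Qed.

Local Open Scope complex_scope.
Let C : numFieldType := R[i].

Lemma complex_pair_continuous : continuous (fun z : R * R => z.1 +i* z.2 : C).
Proof.
move=> z; apply/cvgrPdist_le => e e0.
have eE : e = (complex.Re e)%:C.
  by apply/eqP; rewrite eq_complex /= eqxx /=; apply/eqP/ger0_Im/ltW.
have e2 : 0 < complex.Re e / 2.
  by rewrite divr_gt0//; move: e0; rewrite [e]eE ltcR.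
have C1 := near_dist_le z e2.
apply: filterS C1 => w zw.
have [z1 z2] : `|z.1 - w.1| <= complex.Re e / 2 /\ `|z.2 - w.2| <= complex.Re e
  / 2.
  by split; apply: le_trans zw; rewrite prod_normE le_max lexx ?orbT.
have nR (x : R) : `|x%:C| = `|x|%:C :> C.
  by rewrite normc_def /= expr0n /= addr0 sqrtr_sqr.
rewrite [X in `|X| <= _]complexE /=.
apply: le_trans (ler_normD _ _) _; rewrite normrM !nR.
have -> : `|'i| = 1 :> C by rewrite normc_def /= expr0n /= add0r expr1n sqrtr1.
by rewrite mul1r -rmorphD eE lecR [leRHS]splitr lerD.
Qed.

Lemma complex_ball_precompact (B : complex_scalars R) :
  precompact [set a : complex_scalars R | `|a| <= B].
Proof.
pose M := complex.Re (B : C).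
have cM := @segment_compact R (- M) M.
have := continuous_compact (continuous_subspaceT complex_pair_continuous)
  (compact_setX cM cM).
move=> /(compact_precompact (@norm_hausdorff C C)); apply: precompact_subset.
move=> a /= aB.
have ReB (z : C) (r : R) : (`|r|%:C : C) <= `|z| -> `|z| <= B -> r \in `[- M,
  M].
  move=> rz /(le_trans rz); rewrite lecE /= => /andP[_ rM].
  by rewrite in_itv /= -ler_norml.
exists (complex.Re (a : C), complex.Im (a : C)) => /=; last by case: (a : C).
split=> /=; apply: ReB aB.
  exact: normc_ge_Re.
have := normc_ge_Re ((a : C) * 'i); rewrite ReiNIm normrN => /le_trans; apply.
rewrite normrM normc_def /= [X in _ * X]normc_def /= expr0n /= add0r expr1n.
by rewrite sqrtr1 mulr1.
Qed.

End ScalarBalls.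

Lemma banach_saks_tfae (F : scalar_field) :
  (forall B : F, precompact [set a : F | `|a| <= B]) ->
  forall A : set (schreier F),
    [<-> banach_saks_set A;
         relatively_P_compact A;
         relatively_weakly_compact A /\ precompact (@schreier_linf F @` A)].
Proof.
move=> cF A; tfae=> [bsA u Au|PA|[wA pA]].
- have [C C0 AC] := banach_saks_norm_bounded bsA.
  have [phi [phiI [l ul]]] := banach_saks_sup_rel_compact cF bsA Au.
  exists phi; split=> //; exists l.
  exact: (sup_converges_P_converges (C := C)) (fun n => AC _ (Au _)) ul.
- apply: sup_rel_compact_weakly_compact.
    exact: P_compact_norm_bounded.
  exact: P_compact_sup_rel_compact.
- apply: sup_rel_compact_banach_saks; first exact: weakly_compact_norm_bounded.
  exact: weakly_compact_sup_rel_compact.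
Qed.

Theorem proposition16 (R : realType) :
  (forall A : set (schreier (real_scalars R)),
    [<-> banach_saks_set A;
         relatively_P_compact A;
         relatively_weakly_compact A /\
           precompact (@schreier_linf (real_scalars R) @` A)]) /\
  (forall A : set (schreier (complex_scalars R)),
    [<-> banach_saks_set A;
         relatively_P_compact A;
         relatively_weakly_compact A /\
           precompact (@schreier_linf (complex_scalars R) @` A)]).
Proof.
split; apply: banach_saks_tfae.
  exact: real_ball_precompact.
exact: complex_ball_precompact.
Qed.
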